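(* Let $n,m\ge 1$ be integers and let $T$ be an operator such that, for some $1<p_0<\infty$, $T:L^{p_0}(w)\to L^{p_0}(w)$ is uniformly compact with respect to $A_{p_0}(\mathbb R^{n+m})$. Then, for every $1<p,q<\infty$, $T:L^p_uL^q_v(\mathbb R^{n+m})\to L^p_uL^q_v(\mathbb R^{n+m})$ is uniformly compact with respect to $(A_p,A_q)$.
   Context: Weights. A weight on $\mathbb R^d$ is a non-negative, locally integrable function, not a.e. zero. For $1<p<\infty$, $w\in A_p(\mathbb R^d)$ if $[w]_{A_p}=\sup_Q \left(\frac1{|Q|}\int_Q w\right)\left(\frac1{|Q|}\int_Q w^{1-p'}\right)^{p-1}<\infty$, the supremum being over all cubes $Q\subset\mathbb R^d$, with $\frac1p+\frac1{p'}=1$. Spaces. $L^{p}(w)$ is the weighted Lebesgue space with norm $\left(\int |f|^p w\right)^{1/p}$. For $1\le p,q<\infty$ and weights $u$ on $\mathbb R^n$, $v$ on $\mathbb R^m$, $L^p_uL^q_v(\mathbb R^{n+m})$ is the space of measurable $f:\mathbb R^{n+m}\to\mathbb C$ with $$\|f\|_{L^p_uL^q_v}=\left(\int_{\mathbb R^n}\left[\int_{\mathbb R^m}|f(x,y)|^q v(y)\,dy\right]^{p/q}u(x)\,dx\right)^{1/p}<\infty .$$ Operators. An operator $T$ as in the claim is a map defined on $\bigcup_{w\in A_{p_0}(\mathbb R^{n+m})}L^{p_0}(w)$ with values in (a.e. classes of) measurable functions on $\mathbb R^{n+m}$. (This union contains $L^p_uL^q_v$ for all $1<p,q<\infty$,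 $u\in A_p(\mathbb R^n)$, $v\in A_q(\mathbb R^m)$.) Uniform compactness, mixed-norm case. $T$ is uniformly compact in $L^p_uL^q_v$ with respect to $(A_p,A_q)$ if there is an increasing function $\varphi:(0,\infty)\to(0,\infty)$ such that (weights $u$ are in $A_p(\mathbb R^n)$ and $v$ in $A_q(\mathbb R^m)$ throughout): (1) for every $K\ge1$ and every $u,v$ with $\max([u]_{A_p},[v]_{A_q})\le K$, $\sup_{\|f\|_{L^p_uL^q_v}\le1}\|Tf\|_{L^p_uL^q_v}\le\varphi(K)$; (2) for every $\varepsilon>0$ and $K\ge1$ there is $R=R(\varepsilon,K)>0$ such that $$\sup_{\max([u]_{A_p},[v]_{A_q})\le K}\ \sup_{\|f\|_{L^p_uL^q_v}\le1}\|\chi_{B(0,R)^c}Tf\|_{L^p_uL^q_v}\le\varphi(K)\varepsilon ,$$ where $B(0,R)$ is the ball in $\mathbb R^{n+m}$; (3) for every $\varepsilon>0$ and $K\ge1$ there is $\delta=\delta(\varepsilon,K)>0$ such that for every $h=(h_1,h_2)\in\mathbb R^n\times\mathbb R^m$ with $|h|\le\delta$, $$\sup_{\max([u]_{A_p},[v]_{A_q})\le K}\ \sup_{\|f\|_{L^p_uL^q_v}\le1}\|Tf-Tf(\cdot+h_1,\cdot+h_2)\|_{L^p_uL^q_v}\le\varphi(K)\varepsilon .$$ Uniform compactness, Lebesgue case. $T:L^{p_0}(w)\to L^{p_0}(w)$ is uniformly compact with respect to $A_{p_0}(\mathbb R^{n+m})$ if there is an increasing $\varphi:(0,\infty)\to(0,\infty)$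 such that the analogues of (1)-(3) hold with the norm of $L^{p_0}(w)$ on $\mathbb R^{n+m}$ in place of that of $L^p_uL^q_v$, and with ''all $w\in A_{p_0}(\mathbb R^{n+m})$ with $[w]_{A_{p_0}}\le K$'' in place of ''all $u,v$ with $\max([u]_{A_p},[v]_{A_q})\le K$''. *)

(* Defs.v *)
From HB Require Import structures.
From mathcomp Require Import all_boot all_order all_algebra.
From mathcomp Require Import complex.
From mathcomp Require Import all_classical all_reals all_analysis.
Set Implicit Arguments.
Unset Strict Implicit.
Unset Printing Implicit Defensive.
Import Order.TTheory GRing.Theory Num.Theory.
Import numFieldNormedType.Exports.
Local Open Scope classical_set_scope.
Local Open Scope ring_scope.

Section measurable_rV.
Context (R : realType) (d : nat).

Let coord (i : 'I_d) (x : 'rV[R]_d) : R := x ord0 i.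

Let rV_set0 : g_sigma_preimage coord set0.
Proof. exact: sigma_algebra0. Qed.

Let rV_setC A : g_sigma_preimage coord A -> g_sigma_preimage coord (~` A).
Proof. exact: sigma_algebraC. Qed.

Let rV_bigcup (F : (set 'rV[R]_d)^nat) :
  (forall i, g_sigma_preimage coord (F i)) ->
  g_sigma_preimage coord (\bigcup_i (F i)).
Proof. exact: sigma_algebra_bigcup. Qed.

(* The sigma-algebra generated by the coordinates, i.e. the Borel sets. *)
HB.instance Definition _ :=
  @isMeasurable.Build (measure_tuple_display default_measure_display)
    'rV[R]_d (g_sigma_preimage coord) rV_set0 rV_setC rV_bigcup.

Lemma measurable_rV_coord (i : 'I_d) :
  measurable_fun [set: 'rV[R]_d] (fun x : 'rV[R]_d => x ord0 i : R).
Proof.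
move=> _ Y mY; rewrite setTI; apply: sub_sigma_algebra => /=.
rewrite -bigcup_seq/=; exists i => /=; first by rewrite mem_index_enum.
by exists Y => //; rewrite setTI.
Qed.

Lemma measurable_fun_rVP d1 (T1 : measurableType d1) (f : T1 -> 'rV[R]_d) :
  measurable_fun [set: T1] f <->
  forall i, measurable_fun [set: T1] (fun t => f t ord0 i : R).
Proof.
split=> [mf i|mf].
  exact: (measurableT_comp (measurable_rV_coord i) mf).
move=> _ A mA; rewrite setTI.
suff : g_sigma_preimage coord `<=` [set B | measurable (f @^-1` B)] by apply.
apply: smallest_sub.
  split.
  - by rewrite /= preimage_set0.
  - by move=> B /= mB; rewrite setTD preimage_setC; exact: measurableC.
  - by move=> F mF /=; rewrite preimage_bigcup; exact: bigcupT_measurable.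
rewrite -bigcup_seq; apply: bigcup_sub => i _ B [C mC <-] /=.
by rewrite setTI -comp_preimage -[X in measurable X]setTI; exact: mf.
Qed.

End measurable_rV.

Section lebesgue_rV_step.
Context (R : realType) (d : nat).
Variable mu : {sigma_finite_measure set 'rV[R]_d -> \bar R}.
Local Open Scope ereal_scope.

Definition rV_cons (z : measurableTypeR R * 'rV[R]_d) : 'rV[R]_d.+1 :=
  row_mx (const_mx z.1 : 'rV[R]_1) z.2.

Lemma measurable_rV_cons : measurable_fun setT rV_cons.
Proof.
apply/measurable_fun_rVP => k; rewrite /rV_cons.
rewrite -(fintype.splitK (k : 'I_(1 + d))); case: (fintype.split _) => j /=.
- rewrite [X in measurable_fun _ X](_ : _ = fst)//.
  by apply/funext => z; apply: etrans (row_mxEl _ _ _ _) _; rewrite mxE.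
- rewrite [X in measurable_fun _ X](_ : _ = (fun x : 'rV[R]_d => x ord0 j) \o snd).
    exact: (measurableT_comp (measurable_rV_coord j)).
  by apply/funext => z; exact: row_mxEr.
Qed.

Definition lebesgue_rV_step : set 'rV[R]_d.+1 -> \bar R :=
  pushforward (lebesgue_measure \x mu) rV_cons.

Let step0 : lebesgue_rV_step set0 = 0.
Proof. by rewrite /lebesgue_rV_step /pushforward preimage_set0 measure0. Qed.

Let step_ge0 A : 0 <= lebesgue_rV_step A.
Proof. by rewrite /lebesgue_rV_step /pushforward measure_ge0. Qed.

Let step_sigma_additive : semi_sigma_additive lebesgue_rV_step.
Proof.
move=> F mF tF mUF; rewrite /lebesgue_rV_step /pushforward preimage_bigcup.
apply: measure_semi_sigma_additive.
- by move=> k; rewrite -(setTI (_ @^-1` _)); exact: measurable_rV_cons.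
- apply/trivIsetP => /= k j _ _ kj; rewrite -preimage_setI.
  by move/trivIsetP : tF => /(_ _ _ _ _ kj) ->//; rewrite preimage_set0.
- rewrite -preimage_bigcup -(setTI (_ @^-1` _)).
  exact: measurable_rV_cons.
Qed.

HB.instance Definition _ := isMeasure.Build _ _ _ lebesgue_rV_step
  step0 step_ge0 step_sigma_additive.

Let rV_uncons (x : 'rV[R]_d.+1) : measurableTypeR R * 'rV[R]_d :=
  (x ord0 ord0, rsubmx (x : 'rV[R]_(1 + d))).

Let rV_consK : cancel rV_cons rV_uncons.
Proof.
case=> t x; rewrite /rV_uncons /rV_cons /=; congr pair; last exact: row_mxKr.
by rewrite /row_mx mxE; case: fintype.splitP => // j _; rewrite mxE.
Qed.

Let measurable_rV_uncons : measurable_fun setT rV_uncons.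
Proof.
apply: measurable_fun_pair; first exact: measurable_rV_coord.
apply/measurable_fun_rVP => k.
rewrite [X in measurable_fun _ X](_ : _ =
  fun x : 'rV[R]_d.+1 => x ord0 (rshift 1 k)); first exact: measurable_rV_coord.
by apply/funext => x; rewrite mxE.
Qed.

Let step_sigma_finite : sigma_finite setT lebesgue_rV_step.
Proof.
have /sigma_finiteP[F [TF ndF Foo]] := sigma_finiteT
  (lebesgue_measure : {sigma_finite_measure set (measurableTypeR R) -> \bar R}).
have /sigma_finiteP[G [TG ndG Goo]] := sigma_finiteT mu.
exists (fun k => rV_uncons @^-1` (F k `*` G k)).
  rewrite -preimage_bigcup (_ : \bigcup_k _ = setT) ?preimage_setT//.
  rewrite -setXTT TF TG predeqE => -[t x]; split.
    by move=> [k _ []/= ? ?]; split; exists k.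
  move=> [/= [k _ Fkt] [l _ Glx]]; exists (maxn k l) => //; split.
  - by move: t Fkt; exact/subsetPset/ndF/leq_maxl.
  - by move: x Glx; exact/subsetPset/ndG/leq_maxr.
move=> k; have [mF Fk] := Foo k; have [mG Gk] := Goo k; split.
  rewrite -(setTI (_ @^-1` _)); apply: measurable_rV_uncons => //.
  exact: measurableX.
rewrite /lebesgue_rV_step /pushforward -comp_preimage.
rewrite (_ : rV_uncons \o rV_cons = id); last first.
  by apply/funext => z; exact: rV_consK.
rewrite preimage_id product_measure1E//.
by rewrite lte_mul_pinfty// ge0_fin_numE.
Qed.

HB.instance Definition _ := Measure_isSigmaFinite.Build _ _ _
  lebesgue_rV_step step_sigma_finite.

End lebesgue_rV_step.

Fixpoint lebesgue_rV (R : realType) (d : nat) :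
    {sigma_finite_measure set 'rV[R]_d -> \bar R} :=
  match d with
  | 0%N => @dirac _ 'rV[R]_0 0 R
  | d'.+1 => lebesgue_rV_step (lebesgue_rV R d')
  end.

(* The norm `|x| of 'rV[R]_d is the sup norm, hence this definition. *)
Definition enorm (R : realType) d (x : 'rV[R]_d) : R :=
  Num.sqrt (\sum_(k < d) x ord0 k ^+ 2).

Section weights.
Context (R : realType) (d : nat).
Local Open Scope ereal_scope.
Implicit Types (p : R) (w : 'rV[R]_d -> R) (Q : set 'rV[R]_d).
Local Notation leb := (lebesgue_rV R d).

Definition locally_integrable_rV w :=
  measurable_fun setT w /\
  forall K : set 'rV[R]_d, compact K -> \int[leb]_(x in K) `|w x|%:E < +oo.

Definition weight w :=
  [/\ forall x, (0 <= w x)%R, locally_integrable_rV w &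
      ~ {ae leb, forall x, w x = 0%R}].

Definition cubes : set (set 'rV[R]_d) :=
  [set Q | exists (a : 'rV[R]_d) (l : R), (0 < l)%R /\
     Q = [set x : 'rV[R]_d | forall k, (a ord0 k <= x ord0 k <= a ord0 k + l)%R]].

Definition average Q (g : 'rV[R]_d -> \bar R) : \bar R :=
  (leb Q)^-1 * \int[leb]_(x in Q) g x.

(* powR has 0 `^ s = 0 for s < 0, whereas w^{1-p'} is +oo where w vanishes. *)
Definition dual_weight p w (x : 'rV[R]_d) : \bar R :=
  if w x == 0%R then +oo
  else (w x `^ (1 - fine (hoelder_conjugate p%:E)))%:E.

Definition Ap_const p w : \bar R :=
  ereal_sup [set average Q (EFin \o w) *
                 (average Q (dual_weight p w)) `^ (p - 1) | Q in cubes].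

Definition Ap p : set ('rV[R]_d -> R) :=
  [set w | weight w /\ Ap_const p w < +oo].

End weights.

Section spaces.
Context (R : realType).
Local Open Scope ereal_scope.

Definition cmeasurable d (f : 'rV[R]_d -> R[i]) :=
  measurable_fun setT (fun x => complex.Re (f x)) /\
  measurable_fun setT (fun x => complex.Im (f x)).

Definition Lp_norm d (p : R) (w : 'rV[R]_d -> R) (f : 'rV[R]_d -> R[i]) :
    \bar R :=
  (\int[lebesgue_rV R d]_x (Normc.normc (f x) `^ p * w x)%:E) `^ p^-1.

Definition Lp_space d p (w : 'rV[R]_d -> R) : set ('rV[R]_d -> R[i]) :=
  [set f | cmeasurable f /\ Lp_norm p w f < +oo].

Definition mixed_norm n m (p q : R) (u : 'rV[R]_n -> R) (v : 'rV[R]_m -> R)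
    (f : 'rV[R]_(n + m) -> R[i]) : \bar R :=
  (\int[lebesgue_rV R n]_x
     ((\int[lebesgue_rV R m]_y
         (Normc.normc (f (row_mx x y)) `^ q * v y)%:E) `^ (p / q)
      * (u x)%:E)) `^ p^-1.

End spaces.

Section uniform_compactness.
Context (R : realType) (d : nat).
Local Open Scope ereal_scope.
Implicit Types (f : 'rV[R]_d -> R[i])
  (T : ('rV[R]_d -> R[i]) -> ('rV[R]_d -> R[i])).

(* A map on a.e. classes is given by a map on functions respecting a.e.
   equality; the values of T outside its domain are irrelevant. *)
Definition operator (p0 : R) T :=
  let dom := \bigcup_(w in @Ap R d p0) Lp_space p0 w in
  (forall f, dom f -> cmeasurable (T f)) /\
  (forall f g, dom f -> dom g ->
     {ae lebesgue_rV R d, forall x, f x = g x} ->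
     {ae lebesgue_rV R d, forall x, T f x = T g x}).

Definition outside_ball (r : R) f : 'rV[R]_d -> R[i] :=
  fun x => if (enorm x < r)%R then 0%R else f x.

Definition shift_diff (h : 'rV[R]_d) f : 'rV[R]_d -> R[i] :=
  fun x => (f x - f (x + h))%R.

(* The common shape of the two notions of uniform compactness: W is the type
   of weights (or pairs of weights), adm K the set of those whose constants
   are at most K, and N w the norm defined by w. *)
Definition uniformly_compact_wrt (W : Type) (adm : R -> set W)
    (N : W -> ('rV[R]_d -> R[i]) -> \bar R) T :=
  let unit_ball w := [set f | cmeasurable f /\ N w f <= 1] in
  exists phi : R -> R,
  [/\ (forall t, (0 < t)%R -> (0 < phi t)%R) /\
      (forall s t, (0 < s)%R -> (s <= t)%R -> (phi s <= phi t)%R),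
      forall K, (1 <= K)%R -> forall w, adm K w ->
        ereal_sup [set N w (T f) | f in unit_ball w] <= (phi K)%:E,
      forall eps K, (0 < eps)%R -> (1 <= K)%R -> exists r, (0 < r)%R /\
        ereal_sup [set ereal_sup [set N w (outside_ball r (T f))
                                 | f in unit_ball w] | w in adm K]
          <= (phi K * eps)%:E &
      forall eps K, (0 < eps)%R -> (1 <= K)%R -> exists delta, (0 < delta)%R /\
        forall h : 'rV[R]_d, (enorm h <= delta)%R ->
        ereal_sup [set ereal_sup [set N w (shift_diff h (T f))
                                 | f in unit_ball w] | w in adm K]
          <= (phi K * eps)%:E].

Definition uniformly_compact_Lp (p0 : R) T :=
  uniformly_compact_wrt
    (fun K => [set w | Ap p0 w /\ Ap_const p0 w <= K%:E])
    (fun w => Lp_norm p0 w) T.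

End uniform_compactness.

Definition uniformly_compact_mixed (R : realType) (n m : nat) (p q : R)
    (T : ('rV[R]_(n + m) -> R[i]) -> ('rV[R]_(n + m) -> R[i])) :=
  uniformly_compact_wrt
    (fun K => [set uv : ('rV[R]_n -> R) * ('rV[R]_m -> R) |
       [/\ Ap p uv.1, Ap q uv.2 &
           maxe (Ap_const p uv.1) (Ap_const q uv.2) <= K%:E]%E])
    (fun uv => mixed_norm p q uv.1 uv.2) T.

(* Main.v *)
Require Import Defs.
From mathcomp Require Import all_boot all_order all_algebra.
From mathcomp Require Import complex.
From mathcomp Require Import all_classical all_reals all_analysis.
From mathcomp Require Import measurable_realfun ring lra.
Set Implicit Arguments.
Unset Strict Implicit.
Unset Printing Implicit Defensive.
Import Order.TTheory GRing.Theory Num.Theory.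
Import numFieldNormedType.Exports.
Local Open Scope classical_set_scope.
Local Open Scope ring_scope.

(* Rescaling a weight does not change its A_p constant, so each clause of
   uniform compactness on L^{p0}(w) is a homogeneous inequality between |Tf|,
   |chi Tf| or |Tf - Tf(. + h)| and |f|, uniform over [w] <= K0, although T is
   not assumed linear.  All three clauses therefore follow from one
   quantitative Rubio de Francia extrapolation theorem for pairs (F, G), in
   which a bound at [w]_{A_p} <= K only uses the hypothesis at a single
   constant K0(K).  It is applied twice: on R^{n+m}, from p0 to q; then on R^n,
   from q to p, to the functions x |-> |f(x, .)|_{L^q_v}, because
   [u (x) v]_{A_q} <= [u]_{A_q} [v]_{A_q} on R^{n+m}.

   For the extrapolation one needs the maximal function to be bounded on L^p(w)
   with a constant depending only on [w]_{A_p}.  It is taken over the countably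
   many cubes with rational corners and sides.  For a doubling measure the
   bound follows from the Vitali covering lemma and Doob's argument; Lerner's
   pointwise inequality reduces the Lebesgue maximal function to those of the
   measures w dx and w^{1-p'} dx.  The norms are only compared up to constants,
   so Hoelder's inequality is everywhere replaced by an elementary case
   distinction. *)

(** The test weight [S H^(1 - p0)] treats p < p0 and p > p0 alike: [H] depends on F only, [S] on the
    function dual to G, and its constant comes from two A_1 constants that depend on K but not on F
    or G. Division by [H] requires strict positivity, so a fixed positive function of norm at most 1
    is joined to F, and another to the dual function, before they are majorised.

    T is controlled only on functions that lie in some L^{p0}(w). Extrapolation therefore also
    yields, for each F, one weight w0 with F in L^{p0}(w0); this is where the measurability of Tf
    comes from.

    A weight in A_p may vanish on a null set. It is replaced by an a.e. equal, everywhere positive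
    weight ([Apw]), whose dual weight is real-valued.

    Listing the cubes as a sequence makes the maximal function an increasing limit of finite maxima;
    when the averages are finite, each of these takes finitely many values and its positive
    superlevel sets are finite unions of cubes.

    No monotonicity in K of the extrapolation constant is claimed, so the control function is a sum
    over integer levels. *)

Section cube.
Context (R : realType) (d : nat).
Implicit Types (a x : 'rV[R]_d) (l : R).

Definition cube a l : set 'rV[R]_d :=
  [set x | forall k, a ord0 k <= x ord0 k <= a ord0 k + l].

Lemma cubeP a l : 0 < l -> cubes (cube a l).
Proof. by move=> l0; exists a, l. Qed.

Lemma measurable_cube a l : measurable (cube a l).
Proof.
rewrite (_ : cube a l = \big[setI/setT]_(k < d)
    ((fun x : 'rV[R]_d => x ord0 k) @^-1` `[a ord0 k, a ord0 k + l])).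
  apply: bigsetI_measurable => k _; rewrite -[X in measurable X]setTI.
  exact: measurable_rV_coord.
rewrite -bigcap_seq; apply/seteqP; split=> x /=.
- by move=> xal k _; rewrite /= in_itv/=; exact: xal.
- by move=> xal k; have := xal k (mem_index_enum k); rewrite /= in_itv.
Qed.

(** The cube on the right is the concentric dilate by 3 of [cube a' l'], given by its corner. In
    each coordinate a point of the smaller cube is within [l <= l'] of the common point. *)
Lemma cube_expand a l a' l' : l <= l' -> cube a l `&` cube a' l' !=set0 ->
  cube a l `<=` cube (a' - const_mx l') (3 * l').
Proof.
move=> ll' [z [za za']] x xa k; rewrite !mxE.
by have := za k; have := za' k; have := xa k => *; lra.
Qed.

Lemma cube_sub_expand a l : 0 <= l ->
  cube a l `<=` cube (a - const_mx l) (3 * l).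
Proof.
by move=> l0 x xa k; rewrite !mxE; have := xa k => *; lra.
Qed.

End cube.

(** * Volume of cubes and Tonelli's theorem for the iterated Lebesgue measure *)

Section lebesgue_rV_facts.
Context (R : realType).
Local Open Scope ereal_scope.

Lemma ge0_integral_lebesgue_rVS d (f : 'rV[R]_d.+1 -> \bar R) :
  measurable_fun setT f -> (forall x, 0 <= f x) ->
  \int[lebesgue_rV R d.+1]_x f x =
  \int[lebesgue_measure]_t \int[lebesgue_rV R d]_y f (rV_cons (t, y)).
Proof.
move=> mf f0.
transitivity (\int[lebesgue_measure \x lebesgue_rV R d]_z f (rV_cons z)).
  rewrite -[RHS](@ge0_integral_pushforward _ _ _ _ _ _
    (@measurable_rV_cons R d) (lebesgue_measure \x lebesgue_rV R d) setT)//.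
rewrite fubini_tonelli1//.
exact: measurableT_comp mf (@measurable_rV_cons R d).
Qed.

Lemma rV_cons0 d (z : measurableTypeR R * 'rV[R]_d) :
  rV_cons z ord0 ord0 = z.1.
Proof.
rewrite (_ : ord0 = lshift d (ord0 : 'I_1) :> 'I_(1 + d)); last exact/val_inj.
by rewrite /rV_cons; apply: etrans (row_mxEl _ _ _ _) _; rewrite mxE.
Qed.

Lemma rV_consS d (z : measurableTypeR R * 'rV[R]_d) k :
  rV_cons z ord0 (lift ord0 k) = z.2 ord0 k.
Proof.
rewrite (_ : lift ord0 k = rshift 1 k :> 'I_(1 + d)); last exact/val_inj.
exact: row_mxEr.
Qed.

Lemma lebesgue_rV_cube d (a : 'rV[R]_d) (l : R) : (0 < l)%R ->
  lebesgue_rV R d (cube a l) = (l ^+ d)%:E.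
Proof.
elim: d a => [|d IH] a l0.
  rewrite /= diracE mem_set ?expr0//.
  by move=> -[].
transitivity ((lebesgue_measure \x lebesgue_rV R d)
   (`[a ord0 ord0, (a ord0 ord0 + l)%R] `*`
    cube (rsubmx (a : 'rV[R]_(1 + d))) l)); last first.
  rewrite product_measure1E//; last exact: measurable_cube.
  have ml : lebesgue_measure (`[a ord0 ord0, (a ord0 ord0 + l)%R] : set R) = l%:E.
    rewrite lebesgue_measure_itv /= lte_fin ltrDl l0.
    by rewrite -EFinB addrAC subrr add0r.
  rewrite IH//; apply: etrans (congr1 (fun z => z * _) ml) _.
  by rewrite -EFinM exprS.
rewrite /= /lebesgue_rV_step /pushforward; congr (_ _).
have aE k : rsubmx (a : 'rV[R]_(1 + d)) ord0 k = a ord0 (lift ord0 k).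
  by rewrite mxE; congr (a _ _); exact/val_inj.
apply/seteqP; split=> -[t y] /=.
- move=> ty; split=> [|k] /=.
    by have := ty ord0; rewrite in_itv/= rV_cons0.
  by have := ty (lift ord0 k); rewrite rV_consS aE.
- move=> [tl yl] k; case: (unliftP ord0 k) => [j|] ->.
    by have := yl j; rewrite rV_consS aE.
  by rewrite rV_cons0; move: tl; rewrite in_itv.
Qed.

(** [n.+1 + m] and [(n + m).+1] are convertible, so one coordinate can be peeled off a
    concatenation; this drives the induction that proves Tonelli's theorem on R^{n+m}. *)
Lemma rV_cons_row_mx n m (t : R) (x : 'rV[R]_n) (y : 'rV[R]_m) :
  row_mx (rV_cons (t, x)) y = rV_cons (t, row_mx x y) :> 'rV[R]_(n.+1 + m).
Proof.
apply/rowP => k; case: (unliftP ord0 k) => [j|] -> /=; last first.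
  rewrite rV_cons0 (_ : ord0 = lshift m ord0); last exact/val_inj.
  by rewrite row_mxEl rV_cons0.
rewrite rV_consS /=; case: (fintype.splitP j) => i ji.
  have -> : j = lshift m i by apply/val_inj.
  have -> : lift ord0 (lshift m i) = lshift m (lift ord0 i) by exact/val_inj.
  by rewrite !row_mxEl rV_consS.
have -> : j = rshift n i by apply/val_inj.
have -> : lift ord0 (rshift n i) = rshift n.+1 i by exact/val_inj.
by rewrite !row_mxEr.
Qed.

Lemma measurable_row_mx n m :
  measurable_fun setT (fun z : 'rV[R]_n * 'rV[R]_m => row_mx z.1 z.2).
Proof.
apply/measurable_fun_rVP => k.
case: (fintype.splitP k) => j kj.
  have -> : k = lshift m j by apply/val_inj.
  rewrite [X in measurable_fun _ X](_ : _ =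
     (fun x : 'rV[R]_n => x ord0 j) \o fst); last first.
    by apply/funext => z /=; rewrite row_mxEl.
  exact: measurableT_comp (measurable_rV_coord j) _.
have -> : k = rshift n j by apply/val_inj.
rewrite [X in measurable_fun _ X](_ : _ =
   (fun x : 'rV[R]_m => x ord0 j) \o snd); last first.
  by apply/funext => z /=; rewrite row_mxEr.
exact: measurableT_comp (measurable_rV_coord j) _.
Qed.

Lemma ge0_integral_lebesgue_rVD n m (f : 'rV[R]_(n + m) -> \bar R) :
  measurable_fun setT f -> (forall x, 0 <= f x) ->
  \int[lebesgue_rV R (n + m)]_z f z =
  \int[lebesgue_rV R n]_x \int[lebesgue_rV R m]_y f (row_mx x y).
Proof.
elim: n f => [|n IH] f mf f0.
  rewrite integral_dirac//; last first.
    apply: (measurable_fun_fubini_tonelli_F (fun z => f (row_mx z.1 z.2))) => //.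
    exact: measurableT_comp mf (@measurable_row_mx 0 m).
  rewrite diracT mul1e; apply: eq_integral => z _; congr (f _).
  apply/rowP => k; have -> : k = rshift 0 k by apply/val_inj.
  by rewrite row_mxEr; congr (z _ _); apply/val_inj.
have mg : measurable_fun setT (fun z : 'rV[R]_n.+1 * 'rV[R]_m => f (row_mx z.1 z.2)).
  exact: measurableT_comp mf (@measurable_row_mx n.+1 m).
rewrite [LHS](ge0_integral_lebesgue_rVS (d := (n + m)%N))//.
rewrite [RHS]ge0_integral_lebesgue_rVS//; last 2 first.
- by apply: (measurable_fun_fubini_tonelli_F (fun z => f (row_mx z.1 z.2))).
- by move=> x; exact: integral_ge0.
apply: eq_integral => t _.
rewrite IH//.
  by apply: eq_integral => x _; apply: eq_integral => y _; rewrite -rV_cons_row_mx.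
have mt : measurable_fun setT (fun z : 'rV[R]_(n + m) => rV_cons (t : measurableTypeR R, z)).
  exact: measurableT_comp (@measurable_rV_cons R (n + m)) (measurable_pair1 t).
exact: measurableT_comp mf mt.
Qed.

End lebesgue_rV_facts.

(** * Automation for positivity and measurability side conditions *)

Ltac pos_real := solve [repeat first [done | apply: mulr_gt0 | apply: divr_gt0
  | apply: powR_gt0 | apply: exprn_gt0 | rewrite invr_gt0 | lra]].

Ltac nneg_real := solve [repeat first [done | apply: mulr_ge0 | apply: divr_ge0
  | exact: powR_ge0 | exact: exprn_ge0 | rewrite invr_ge0 | apply: ltW; done]].

Ltac nneg := solve [move=> *; repeat first [done
  | apply: integral_ge0 => * | apply: mule_ge0 | apply: adde_ge0
  | exact: poweR_ge0 | rewrite lee_fin; nneg_real]].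

Ltac meas_step := lazymatch goal with
  | |- measurable_fun _ (fun x => mule (@?f x) (@?g x)) => apply: emeasurable_funM
  | |- measurable_fun _ (fun x => GRing.add (@?f x) (@?g x)) => apply: emeasurable_funD
  | |- measurable_fun _ (fun x => maxe (@?f x) (@?g x)) => apply: measurable_maxe
  | |- measurable_fun _ (fun x => poweR (@?f x) _) =>
      apply: (measurableT_comp (measurable_poweR _))
  | |- measurable_fun _ (fun x => EFin (@?f x)) => apply/measurable_EFinP
  | |- measurable_fun _ (fun x => GRing.mul (@?f x) (@?g x)) => apply: measurable_funM
  | |- measurable_fun _ (fun x => powR (@?f x) _) =>
      apply: (measurableT_comp (measurable_powR _))
  end.

Ltac meas := solve [try apply: measurable_funTS;
  repeat first [done | exact: measurable_cst | meas_step]].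

(** * Inequalities and identities for real and extended powers *)

Section powers.
Context {R : realType}.

(** Young's inequality for [a] and [b^(p-1)]. It is the increment form of d(t^p) = p' t d(t^(p-1)),
    with t evaluated at [a], the upper level in its use below. *)
Lemma powR_subr_le (p a b : R) : 1 < p -> 0 <= a -> 0 <= b ->
  a `^ p - b `^ p <= p / (p - 1) * (a * (a `^ (p - 1) - b `^ (p - 1))).
Proof.
move=> p1 a0 b0.
have p10 : 0 < p - 1 by rewrite subr_gt0.
have p0 : 0 < p by lra.
have pN0 : p != 0 by rewrite gt_eqF.
have p1N0 : p - 1 != 0 by rewrite gt_eqF.
have q0 : 0 < p / (p - 1) by rewrite divr_gt0.
have pq : p^-1 + (p / (p - 1))^-1 = 1 by field; rewrite pN0 p1N0.
have := conjugate_powR a0 (powR_ge0 b (p - 1)) p0 q0 pq.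
rewrite -powRrM (_ : (p - 1) * (p / (p - 1)) = p); last by field.
rewrite mulrBr mulr_powRB1// => H.
have -> : p / (p - 1) * (a `^ p - a * b `^ (p - 1)) =
   a `^ p - b `^ p + p / (p - 1) * (a `^ p / p + b `^ p / (p / (p - 1))
     - a * b `^ (p - 1)).
  by field; rewrite pN0 p1N0.
by rewrite lerDl; apply: mulr_ge0; rewrite ?subr_ge0// ltW.
Qed.

(** As [x] is itself one of the levels, the increments of [phi] up to [x] cancel exactly, with no
    remainder from a partial layer. *)
Lemma telescope_sorted (phi : R -> R) (b : R) (s : seq R) (x : R) :
  path <=%R b s -> x \in b :: s ->
  \sum_(c <- zip (b :: s) s) (phi c.2 - phi c.1) * (c.2 <= x)%R%:R =
  phi x - phi b.
Proof.
elim: s b => [|c s IH] b.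
  by rewrite /= big_nil inE => _ /eqP ->; rewrite subrr.
move=> /= /andP[bc pcs] xs; rewrite big_cons /=.
have [cx|xc] := leP c x.
  rewrite IH//; first by rewrite mulr1 addrC addrA subrK.
  move: xs; rewrite inE => /orP[/eqP xb|//].
  by rewrite inE (_ : x = c) ?eqxx//; apply/eqP; rewrite eq_le cx xb bc.
have sx : forall y, y \in c :: s -> x < y.
  move=> y; rewrite inE => /orP[/eqP -> //|ys].
  apply: (lt_le_trans xc).
  by move: pcs; rewrite (path_sortedE le_trans) => /andP[/allP/(_ _ ys)].
have xb : x = b by move: xs; rewrite inE => /orP[/eqP //|/sx]; rewrite ltxx.
rewrite xb mulr0 add0r subrr big1_seq// => -[y z] /= yz.
have zs : z \in s.
  by rewrite -(@unzip2_zip _ _ (c :: s) s)//; exact: (map_f snd yz).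
have := sx z; rewrite inE zs orbT xb => /(_ isT).
by rewrite ltNge => /negbTE ->; rewrite mulr0.
Qed.

End powers.

Section epowers.
Context {R : realType}.
Local Open Scope ereal_scope.
Implicit Types x y : \bar R.

Lemma le_poweR x y (r : R) : (0 <= r)%R -> 0 <= x -> x <= y ->
  x `^ r <= y `^ r.
Proof.
move=> r0 x0 xy; apply: gt0_ler_poweR => //.
- by rewrite in_itv/= x0 leey.
- by rewrite in_itv/= leey andbT; exact: le_trans xy.
Qed.

Lemma poweRK x (r : R) : r != 0%R -> 0 <= x -> (x `^ r) `^ r^-1 = x.
Proof. by move=> r0 x0; rewrite -poweRrM divff// poweRe1. Qed.

Lemma poweRVK x (r : R) : r != 0%R -> 0 <= x -> (x `^ r^-1) `^ r = x.
Proof. by move=> r0 x0; rewrite -poweRrM mulVf// poweRe1. Qed.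

Lemma poweR_le_inv x y (r : R) : (0 < r)%R -> 0 <= x -> 0 <= y ->
  (x `^ r <= y) = (x <= y `^ r^-1).
Proof.
move=> r0 x0 y0; have rN0 : r != 0%R by rewrite gt_eqF.
apply/idP/idP => [xy|xy].
  by rewrite -[leLHS](poweRK rN0)//; apply: le_poweR => //; rewrite ?poweR_ge0// invr_ge0 ltW.
by rewrite -[leRHS](poweRVK rN0)//; apply: le_poweR => //; rewrite ltW.
Qed.

Lemma ereal_sup_range_ge0 (h : nat -> \bar R) : (forall n, 0 <= h n) ->
  0 <= ereal_sup (range h).
Proof.
by move=> h0; apply: le_trans (h0 0%N) _; apply: ereal_sup_ubound; exists 0%N.
Qed.

(** The map t -> t^r c is an increasing bijection of [0, +oo]; applying its inverse gives the
    nontrivial inequality. *)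
Lemma poweR_ereal_supM (h : nat -> \bar R) (r c : R) : (0 < r)%R -> (0 < c)%R ->
  (forall n, 0 <= h n) ->
  ereal_sup (range h) `^ r * c%:E = ereal_sup (range (fun n => h n `^ r * c%:E)).
Proof.
move=> r0 c0 h0; apply/eqP; rewrite eq_le; apply/andP; split; last first.
  apply: ge_ereal_sup => _ [n _ <-]; apply: lee_wpmul2r; first by rewrite lee_fin ltW.
  by apply: le_poweR => //; [exact: ltW|apply: ereal_sup_ubound; exists n].
rewrite -lee_pdivlMr// poweR_le_inv//; last 2 first.
- exact: ereal_sup_range_ge0.
- apply: mule_ge0; last by rewrite lee_fin invr_ge0 ltW.
  by apply: ereal_sup_range_ge0 => n; rewrite mule_ge0 ?poweR_ge0// lee_fin ltW.
apply: ge_ereal_sup => _ [n _ <-]; rewrite -poweR_le_inv//.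
  by rewrite lee_pdivlMr//; apply: ereal_sup_ubound; exists n.
apply: mule_ge0; last by rewrite lee_fin invr_ge0 ltW.
by apply: ereal_sup_range_ge0 => k; rewrite mule_ge0 ?poweR_ge0// lee_fin ltW.
Qed.

End epowers.

(** * Monotone limits, layer sums and subadditivity of integrals *)

Section integrals.
Context d (T : measurableType d) (R : realType) (mu : {measure set T -> \bar R}).
Local Open Scope ereal_scope.

Lemma measurable_ereal_sup (h : nat -> T -> \bar R) :
  (forall n, measurable_fun setT (h n)) ->
  measurable_fun setT (fun x => ereal_sup (range (h^~ x))).
Proof.
move=> mh; have := measurable_fun_esups mh 0%N; congr measurable_fun.
apply/funext => x; rewrite /esups/=; congr ereal_sup; apply/seteqP; split.
- by move=> _ [n _ <-]; exists n.
- by move=> _ [n _ <-]; exists n.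
Qed.

Lemma integral_ereal_sup (D : set T) (h : nat -> T -> \bar R) : measurable D ->
  (forall n, measurable_fun setT (h n)) -> (forall n x, 0 <= h n x) ->
  (forall x, {homo h^~ x : n m / (n <= m)%N >-> n <= m}) ->
  \int[mu]_(x in D) ereal_sup (range (h^~ x)) =
  ereal_sup (range (fun n => \int[mu]_(x in D) h n x)).
Proof.
move=> mD mh h0 ndh.
transitivity (\int[mu]_(x in D) (limn (h^~ x))).
  apply: eq_integral => x _; apply/esym/cvg_lim => //.
  exact: ereal_nondecreasing_cvgn.
have mhD n : measurable_fun D (h n) by exact: measurable_funTS.
rewrite monotone_convergence//.
apply/cvg_lim => //; apply: ereal_nondecreasing_cvgn => n m nm.
by apply: ge0_le_integral => // x _; exact: ndh.
Qed.

(** Every passage to the limit uses this form of monotone convergence: finite maxima of averages,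
    the Rubio de Francia iterates, and the truncations in the duality argument. *)
Lemma integral_poweR_sup_le (h : nat -> T -> \bar R) (w : T -> R) (r : R)
    (C : \bar R) : (0 < r)%R -> measurable_fun setT w -> (forall x, (0 < w x)%R) ->
  (forall n, measurable_fun setT (h n)) -> (forall n x, 0 <= h n x) ->
  (forall x, {homo h^~ x : n m / (n <= m)%N >-> n <= m}) ->
  (forall n, \int[mu]_x (h n x `^ r * (w x)%:E) <= C) ->
  \int[mu]_x (ereal_sup (range (h^~ x)) `^ r * (w x)%:E) <= C.
Proof.
move=> r0 mw w0 mh h0 ndh hC.
rewrite (eq_integral (fun x => ereal_sup (range (fun n => h n x `^ r * (w x)%:E)))); last first.
  by move=> x _; rewrite poweR_ereal_supM.
rewrite (@integral_ereal_sup setT (fun n x => h n x `^ r * (w x)%:E))//.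
- by apply: ge_ereal_sup => _ [n _ <-]; exact: hC.
- move=> n; apply: emeasurable_funM; last exact/measurable_EFinP.
  exact: measurableT_comp (measurable_poweR r) (mh n).
- by move=> n x; rewrite mule_ge0 ?poweR_ge0// lee_fin ltW.
- move=> x n m nm; apply: lee_wpmul2r; first by rewrite lee_fin ltW.
  by apply: le_poweR => //; [exact: ltW|exact: ndh].
Qed.

(* Abel summation over the finitely many values of g replaces the layer-cake
   formula of Doob's inequality. *)
Lemma doob_layers (g : T -> R) (s : seq R) (W V : T -> \bar R) (p : R) :
  (1 < p)%R -> measurable_fun setT g -> path <=%R 0%R s ->
  (forall x, g x \in 0%R :: s) ->
  measurable_fun setT W -> (forall x, 0 <= W x) ->
  measurable_fun setT V -> (forall x, 0 <= V x) ->
  (forall c : R, (0 < c)%R ->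
     c%:E * \int[mu]_(x in [set x | (c <= g x)%R]) W x <=
     \int[mu]_(x in [set x | (c <= g x)%R]) V x) ->
  \int[mu]_x ((g x `^ p)%:E * W x) <=
  (p / (p - 1))%:E * \int[mu]_x ((g x `^ (p - 1))%:E * V x).
Proof.
move=> p1 mg s0 gs mW W0 mV V0 WV.
have p10 : (0 < p - 1)%R by rewrite subr_gt0.
have p0 : (0 < p)%R by lra.
have mc c : measurable [set x | (c <= g x)%R].
  have := mg measurableT _ (measurable_itv `[c, +oo[).
  rewrite setTI; congr measurable; apply/seteqP.
  by split=> x /=; rewrite in_itv/= andbT.
have gE (r : R) x : (0 < r)%R -> (g x `^ r)%R =
    (\sum_(c <- zip (0%R :: s) s) (c.2 `^ r - c.1 `^ r) * (c.2 <= g x)%R%:R)%R.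
  move=> r0; rewrite (telescope_sorted (fun t => t `^ r)%R s0 (gs x)).
  by rewrite powR0 ?gt_eqF// subr0.
have s_ge b (t : seq R) : path <=%R b t -> (0 <= b)%R ->
    forall c, c \in zip (b :: t) t -> (0 <= c.1)%R && (c.1 <= c.2)%R.
  elim: t b => [|e t IH] b //= /andP[be pt] b0 c; rewrite inE => /orP[/eqP ->|] /=.
    by rewrite b0.
  by apply: IH => //; exact: le_trans be.
have {}s_ge := s_ge _ _ s0 (lexx 0%R).
pose k (r : R) (c : R * R) : R := (c.2 `^ r - c.1 `^ r)%R.
pose zs := zip (0%R :: s) s.
have k0 r (c : R * R) : (0 < r)%R -> c \in zs -> (0 <= k r c)%R.
  move=> r0 /s_ge /andP[c0 cc]; rewrite subr_ge0; apply: ge0_ler_powR => //.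
  - exact: ltW.
  - by rewrite nnegrE (le_trans c0).
have mi c : measurable_fun setT (fun x => ((c <= g x)%R%:R : R)).
  have := @measurable_indic _ T R setT _ (mc c); congr measurable_fun.
  apply/funext => x; rewrite indicE; congr (_%:R); congr nat_of_bool.
  by apply/idP/idP; rewrite inE.
have step (U : T -> \bar R) (r : R) : (0 < r)%R -> measurable_fun setT U ->
    (forall x, 0 <= U x) -> \int[mu]_x ((g x `^ r)%:E * U x) =
    \sum_(c <- zs) (k r c)%:E * \int[mu]_(x in [set x | (c.2 <= g x)%R]) U x.
  move=> r0 mU U0.
  (* Off the list the summand is set to 0, because nonnegativity is asked for every pair [c] while
     [k r c >= 0] holds only for consecutive levels. *)
  pose F (c : R * R) x := if c \in zs then (k r c)%:E * (((c.2 <= g x)%R%:R)%:E * U x) else 0.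
  transitivity (\int[mu]_x (\sum_(c <- zs) F c x)).
    apply: eq_integral => x _; rewrite gE// -sumEFin big_seq ge0_sume_distrl.
      by rewrite [RHS]big_seq; apply: eq_bigr => c czs; rewrite /F czs EFinM muleA.
    by move=> c czs; rewrite lee_fin mulr_ge0//; exact: k0.
  rewrite ge0_integral_sum//.
  - apply: eq_big_seq => c czs; rewrite /F czs.
    rewrite ge0_integralZl_EFin//; last by apply: k0.
    + congr (_ * _); apply/esym; rewrite integral_mkcond.
      apply: eq_integral => x _; rewrite patchE.
      case: ifPn => [|]; first by rewrite inE/= => ->; rewrite mul1e.
      by rewrite notin_setE/= => /negP/negbTE ->; rewrite mul0e.
    + by move=> x _; rewrite mule_ge0.
    + apply: emeasurable_funM => //; exact/measurable_EFinP.
  - move=> c; rewrite /F; case: (c \in zs); last exact: measurable_cst.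
    apply: emeasurable_funM => //; apply: emeasurable_funM => //; exact/measurable_EFinP.
  - move=> c x _; rewrite /F; case: ifPn => // czs.
    by rewrite mule_ge0// ?mule_ge0// lee_fin k0.
rewrite !step// ![\sum_(_ <- zs) _]big_seq ge0_sume_distrr; last first.
  by move=> c czs; rewrite mule_ge0 ?lee_fin ?k0//; exact: integral_ge0.
apply: lee_sum => c czs; have /andP[c1 cc] := s_ge _ czs.
set IW := integral _ _ _; set IV := integral _ _ _.
have IW0 : 0 <= IW by exact: integral_ge0.
(* The level inequality is assumed only for positive levels; a layer whose upper end is 0 has both
   ends 0 and contributes nothing. *)
have [c20|c20] := leP c.2 0%R.
  have c2 : c.2 = 0%R by apply/eqP; rewrite eq_le c20 (le_trans c1).
  have c10 : c.1 = 0%R by apply/eqP; rewrite eq_le c1 -c2 cc.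
  have -> : k p c = 0%R by rewrite /k c2 c10 subrr.
  rewrite mul0e; apply: mule_ge0; first by rewrite lee_fin divr_ge0 ?ltW.
  by apply: mule_ge0; [rewrite lee_fin k0|exact: integral_ge0].
apply: (@le_trans _ _ ((p / (p - 1) * (c.2 * k (p - 1)%R c))%:E * IW)).
  by apply: lee_wpmul2r => //; rewrite lee_fin powR_subr_le// ltW.
rewrite EFinM -muleA; apply: lee_wpmul2l; first by rewrite lee_fin divr_ge0 ?ltW.
rewrite mulrC EFinM -muleA; apply: lee_wpmul2l; first by rewrite lee_fin k0.
exact: WV.
Qed.

End integrals.

Section integrals2.
Context d (T : measurableType d) (R : realType) (mu : {measure set T -> \bar R}).
Local Open Scope ereal_scope.

Lemma ge0_integral_gt0 (D : set T) (f : T -> \bar R) : measurable D ->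
  measurable_fun D f -> (forall x, D x -> 0 < f x) -> 0 < mu D ->
  0 < \int[mu]_(x in D) f x.
Proof.
move=> mD mf f0 D0; rewrite lt_def; apply/andP; split; last first.
  by apply: integral_ge0 => x /f0/ltW.
apply/eqP => f_eq0.
have : \int[mu]_(x in D) `|f x| = 0.
  by rewrite -f_eq0; apply: eq_integral => x /set_mem Dx; rewrite gee0_abs// ltW// f0.
move/(ae_eq_integral_abs mu mD mf) => [N [mN N0 DN]].
have : mu D <= mu N.
  apply: le_measure; rewrite ?inE// => x Dx; apply: DN => /=.
  by move/(_ Dx) => fx0; have := f0 _ Dx; rewrite fx0 ltxx.
by rewrite N0 leNgt D0.
Qed.

Lemma ge0_integral_setU_le (A B : set T) (f : T -> \bar R) : measurable A ->
  measurable B -> measurable_fun setT f -> (forall x, 0 <= f x) ->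
  \int[mu]_(x in A `|` B) f x <= \int[mu]_(x in A) f x + \int[mu]_(x in B) f x.
Proof.
move=> mA mB mf f0; have mBA := measurableD mB mA.
have -> : A `|` B = A `|` (B `\` A).
  apply/seteqP; split=> x; last by move=> [|[]]; [left|right].
  by move=> [|Bx]; [left|have [Ax|Ax] := pselect (A x); [left|right]].
rewrite ge0_integral_setU//; last 2 first.
- exact: measurable_funTS.
- by apply/disj_setPS => x [Ax []].
apply: leeD => //; apply: ge0_subset_integral => //.
exact: measurable_funTS.
Qed.

Lemma ge0_integral_bigsetU_le (I : eqType) (s : seq I) (F : I -> set T)
    (f : T -> \bar R) : (forall i, measurable (F i)) ->
  measurable_fun setT f -> (forall x, 0 <= f x) ->
  \int[mu]_(x in \big[setU/set0]_(i <- s) F i) f x <=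
  \sum_(i <- s) \int[mu]_(x in F i) f x.
Proof.
move=> mF mf f0; elim: s => [|i s IH]; first by rewrite !big_nil integral_set0.
rewrite !big_cons; apply: le_trans (ge0_integral_setU_le _ _ _ _) _ => //.
  exact: bigsetU_measurable.
by apply: leeD.
Qed.

End integrals2.

(** * The Vitali covering lemma for finitely many cubes *)

Section vitali.
Context (R : realType) (d : nat) (a : nat -> 'rV[R]_d) (l : nat -> R).
Hypothesis l0 : forall i, 0 < l i.
Local Notation Q i := (cube (a i) (l i)).

Lemma seq_argmax (f : nat -> R) (s : seq nat) : s != [::] ->
  exists2 i, i \in s & forall j, j \in s -> f j <= f i.
Proof.
elim: s => // i s IH _; have [->|s0] := eqVneq s [::].
  by exists i; rewrite ?mem_head// => j; rewrite inE => /eqP ->.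
have [k ks kmax] := IH s0; have [ik|ki] := leP (f i) (f k).
  exists k; first by rewrite inE ks orbT.
  by move=> j; rewrite inE => /orP[/eqP ->//|/kmax].
exists i; first by rewrite mem_head.
by move=> j; rewrite inE => /orP[/eqP ->//|/kmax /le_trans]; apply; exact: ltW.
Qed.

(** Greedy selection by induction on the length of the list: a cube of maximal side is kept, and all
    cubes that meet it are dropped, since they lie in its dilate by 3. *)
Lemma vitali_cubes (s : seq nat) : exists D : seq nat,
  [/\ uniq D, {subset D <= s}, trivIset [set` D] (fun i => Q i) &
    forall i, i \in s -> exists2 j, j \in D &
      Q i `<=` cube (a j - const_mx (l j)) (3 * l j)].
Proof.
have [n] := ubnP (size s); elim: n s => // n IH s; rewrite ltnS => sn.
have [->|s0] := eqVneq s [::].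
  by exists [::]; split => // i j; rewrite /= in_nil.
have [i0 i0s i0max] := seq_argmax l s0.
pose P i := `[< Q i `&` Q i0 = set0 >].
pose s' := [seq i <- s | P i].
have Q0 i : Q i (a i) by move=> k; rewrite lexx lerDl ltW.
have i0s' : i0 \notin s'.
  rewrite mem_filter i0s andbT; apply/asboolP; rewrite setIid => /seteqP[/(_ (a i0))].
  by move=> /(_ (Q0 i0)).
(* The chosen cube meets itself, so at least [i0] leaves the list. *)
have ss' : (size s' < n)%N.
  apply: leq_trans sn; rewrite size_filter -(count_predC P s).
  rewrite -[X in (X < _)%N]addn0 ltn_add2l -has_count; apply/hasP; exists i0 => //=.
  by move: i0s'; rewrite mem_filter i0s andbT.
have [D [uD Ds' tD covD]] := IH _ ss'.
have Ds'0 j : j \in D -> Q j `&` Q i0 = set0.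
  by move/Ds'; rewrite mem_filter => /andP[/asboolP].
exists (i0 :: D); split.
- by rewrite /= uD andbT; apply: contra i0s' => /Ds'.
- move=> j; rewrite inE => /orP[/eqP ->//|/Ds'].
  by rewrite mem_filter => /andP[].
- apply/trivIsetP => i j /=; rewrite !inE.
  move=> /orP[/eqP ->|iD] /orP[/eqP ->|jD]; rewrite ?eqxx// => ij.
  + by rewrite setIC Ds'0.
  + by rewrite Ds'0.
  + by move/trivIsetP : tD; apply.
- move=> i si; have [Pi|] := boolP (P i).
    have [|j jD Qij] := covD i; first by rewrite mem_filter Pi.
    by exists j => //; rewrite inE jD orbT.
  move=> /asboolP Pi; exists i0; first by rewrite mem_head.
  by apply: cube_expand; [exact: i0max|exact/set0P/eqP].
Qed.

End vitali.

(** * Positive weights, doubling and the weak-type estimate *)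

Section weights.
Context (R : realType) (d : nat).
Local Open Scope ereal_scope.
Local Notation mu := (lebesgue_rV R d).
Implicit Types (w : 'rV[R]_d -> R) (f g : 'rV[R]_d -> \bar R).

(** Positivity is asked at every point, so that reciprocals and negative powers of the weight are
    real and positive everywhere. *)
Definition locally_finite_weight w := [/\ measurable_fun setT w,
  forall x, (0 < w x)%R &
  forall a l, (0 < l)%R -> \int[mu]_(x in cube a l) (w x)%:E < +oo].

Definition wcube w a l : R := fine (\int[mu]_(x in cube a l) (w x)%:E).

Lemma wcubeE w a l : locally_finite_weight w -> (0 < l)%R ->
  \int[mu]_(x in cube a l) (w x)%:E = (wcube w a l)%:E.
Proof.
move=> [mw w0 wfin] l0; rewrite fineK// ge0_fin_numE; first exact: wfin.
by apply: integral_ge0 => x _; rewrite lee_fin ltW.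
Qed.

Lemma wcube_gt0 w a l : locally_finite_weight w -> (0 < l)%R ->
  (0 < wcube w a l)%R.
Proof.
move=> lw l0; rewrite -lte_fin -wcubeE//; case: lw => mw w0 wfin.
have D0 : 0 < mu (cube a l) by rewrite lebesgue_rV_cube// lte_fin exprn_gt0.
apply: ge0_integral_gt0.
- exact: measurable_cube.
- by apply: measurable_funTS; exact/measurable_EFinP.
- by move=> x _; rewrite lte_fin.
- exact: D0.
Qed.

Definition doubling w (C : R) := forall a l, (0 < l)%R ->
  (wcube w (a - const_mx l) (3 * l) <= C * wcube w a l)%R.

(** The selected cubes are disjoint and their dilates cover the union; doubling compares each dilate
    with its cube. The right-hand integral runs over the same union as the left one, not over the
    whole space, which is the form that summation over level sets requires. *)
Lemma weak_type w f (C c : R) (a : nat -> 'rV[R]_d) (l : nat -> R)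
    (s : seq nat) : (forall i, (0 < l i)%R) ->
  locally_finite_weight w -> doubling w C -> (0 <= C)%R -> (0 < c)%R ->
  measurable_fun setT f -> (forall x, 0 <= f x) ->
  (forall i, i \in s -> (c * wcube w (a i) (l i))%:E <=
     \int[mu]_(x in cube (a i) (l i)) (f x * (w x)%:E)) ->
  c%:E * \int[mu]_(x in \big[setU/set0]_(i <- s) cube (a i) (l i)) (w x)%:E <=
  \int[mu]_(x in \big[setU/set0]_(i <- s) cube (a i) (l i)) (C%:E * (f x * (w x)%:E)).
Proof.
move=> l0 lw dw C0 c0 mf f0 fc; have [mw w0 wfin] := lw.
have mEw : measurable_fun setT (EFin \o w) by exact/measurable_EFinP.
have mfw : measurable_fun setT (fun x => f x * (w x)%:E) by exact: emeasurable_funM.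
have fw0 x : 0 <= f x * (w x)%:E by rewrite mule_ge0// lee_fin ltW.
have mQ i : measurable (cube (a i) (l i)) by exact: measurable_cube.
have mU t : measurable (\big[setU/set0]_(i <- t) cube (a i) (l i)).
  exact: bigsetU_measurable.
have [D [uD Ds tD covD]] := vitali_cubes a l0 s.
rewrite ge0_integralZl_EFin//; last exact: measurable_funTS.
apply: (@le_trans _ _ (C%:E * \sum_(j <- D) (c * wcube w (a j) (l j))%:E)); last first.
  apply: lee_wpmul2l; first by rewrite lee_fin.
  apply: (@le_trans _ _ (\int[mu]_(x in \big[setU/set0]_(j <- D) cube (a j) (l j))
      (f x * (w x)%:E))).
    rewrite ge0_integral_bigsetU//; last exact: measurable_funTS.
    by rewrite big_seq [leRHS]big_seq; apply: lee_sum => j /Ds; exact: fc.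
  apply: ge0_subset_integral => //; first exact: measurable_funTS.
  rewrite -!bigcup_seq => x [j jD Qj]; exists j => //; exact: Ds.
rewrite ge0_sume_distrr; last first.
  by move=> j _; rewrite lee_fin mulr_ge0 ?ltW// wcube_gt0.
apply: (@le_trans _ _ (c%:E * \sum_(j <- D) (wcube w (a j - const_mx (l j)) (3 * l j))%:E)).
  apply: lee_wpmul2l; first by rewrite lee_fin ltW.
  apply: (@le_trans _ _ (\int[mu]_(x in \big[setU/set0]_(j <- D)
      cube (a j - const_mx (l j)) (3 * l j)) (w x)%:E)).
    apply: ge0_subset_integral => //.
    - by apply: bigsetU_measurable => j _; exact: measurable_cube.
    - exact: measurable_funTS.
    - by move=> x _; rewrite lee_fin ltW.
    - rewrite -!bigcup_seq => x [i /= si Qi]; have [j jD ij] := covD i si.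
      by exists j => //; exact: ij.
  apply: le_trans (ge0_integral_bigsetU_le _ _ _ _ _) _ => //.
  - by move=> j; exact: measurable_cube.
  - by move=> x; rewrite lee_fin ltW.
  - by apply: lee_sum => j _; rewrite wcubeE// mulr_gt0.
rewrite ge0_sume_distrr; last first.
  by move=> j _; rewrite lee_fin ltW// wcube_gt0// mulr_gt0.
apply: lee_sum => j _; rewrite -!EFinM lee_fin mulrCA.
by apply: ler_wpM2l; [exact: ltW|exact: dw].
Qed.

End weights.

(** * Running maxima of sequences, started at 0 *)

Section running_max.
Context {R : realType}.

Fixpoint pmaxr (c : nat -> R) n : R :=
  if n is k.+1 then Num.max (pmaxr c k) (c k) else 0.

Fixpoint pmaxe (c : nat -> \bar R) n : \bar R :=
  if n is k.+1 then maxe (pmaxe c k) (c k) else 0%E.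

Lemma pmaxe_EFin (c : nat -> R) n : pmaxe (fun i => (c i)%:E) n = (pmaxr c n)%:E.
Proof. by elim: n => //= n ->; rewrite EFin_max. Qed.

Lemma pmaxe_ge0 c n : (0 <= pmaxe c n)%E.
Proof. by elim: n => //= n IH; rewrite le_max IH. Qed.

Lemma pmaxr_ge0 c n : 0 <= pmaxr c n.
Proof. by elim: n => //= n IH; rewrite le_max IH. Qed.

Lemma pmaxe_nd c : {homo pmaxe c : n m / (n <= m)%N >-> (n <= m)%E}.
Proof.
apply: (@homo_leq _ _ (fun x y => (x <= y)%E)); first by [].
  by move=> y x z; exact: le_trans.
by move=> n /=; rewrite le_max lexx.
Qed.

Lemma pmaxe_ub c n i : (i < n)%N -> (c i <= pmaxe c n)%E.
Proof.
elim: n => // n IH; rewrite ltnS leq_eqVlt => /orP[/eqP ->|/IH ci] /=.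
  by rewrite le_max lexx orbT.
by rewrite le_max ci.
Qed.

Lemma pmaxe_le c n (y : \bar R) : (0 <= y)%E -> (forall i, (c i <= y)%E) ->
  (pmaxe c n <= y)%E.
Proof. by move=> y0 cy; elim: n => //= n IH; rewrite ge_max IH cy. Qed.

(** A finite maximum takes only the listed values; they will be the levels in Doob's argument. *)
Lemma pmaxr_mem c n : pmaxr c n \in 0 :: map c (iota 0 n).
Proof.
elim: n => [|n IH]; first by rewrite /= mem_head.
rewrite -addn1 iotaD map_cat /= add0n addn1 /=.
rewrite -cat_cons mem_cat; case: (leP (pmaxr c n) (c n)) => _.
  by rewrite mem_seq1 eqxx orbT.
by rewrite IH.
Qed.

Lemma pmaxr_ge (e : R) c n : 0 < e ->
  (e <= pmaxr c n) <-> exists2 i, (i < n)%N & e <= c i.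
Proof.
move=> e0; elim: n => [|n IH] /=.
  by split; [rewrite leNgt e0|case].
rewrite le_max; split=> [/orP[/IH [i i_n ei]|ec]|[i +]].
- by exists i => //; exact: ltnW.
- by exists n.
- rewrite ltnS leq_eqVlt => /orP[/eqP -> ->|i_n ei]; first by rewrite orbT.
  by apply/orP; left; apply/IH; exists i.
Qed.

End running_max.

(** * Maximal functions of a doubling measure over a sequence of cubes *)

Section maximal.
Context (R : realType) (d : nat) (a : nat -> 'rV[R]_d) (l : nat -> R).
Hypothesis l0 : forall i, (0 < l i)%R.
Local Open Scope ereal_scope.
Local Notation mu := (lebesgue_rV R d).
Local Notation Q i := (cube (a i) (l i)).
Implicit Types (w : 'rV[R]_d -> R) (f g : 'rV[R]_d -> \bar R).

Definition avgw w f i : \bar R :=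
  (\int[mu]_(x in Q i) (f x * (w x)%:E)) * ((wcube w (a i) (l i))^-1)%:E.

Definition maxop_n w f n x := pmaxe (fun i => (\1_(Q i) x)%:E * avgw w f i) n.

(** The uncentred maximal function of the measure w dx over the listed cubes; [w = cst 1] gives the
    Lebesgue one. *)
Definition maxop w f x := ereal_sup (range (fun n => maxop_n w f n x)).

Lemma avgw_ge0 w f i : locally_finite_weight w -> (forall x, 0 <= f x) ->
  0 <= avgw w f i.
Proof.
move=> lw f0; have [mw w0 _] := lw; apply: mule_ge0.
  by apply: integral_ge0 => x _; rewrite mule_ge0// lee_fin ltW.
by rewrite lee_fin invr_ge0 ltW// wcube_gt0.
Qed.

Lemma measurable_maxop_n w f n : measurable_fun setT (maxop_n w f n).
Proof.
rewrite /maxop_n; elim: n => [|n IH] /=; first exact: measurable_cst.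
apply: measurable_maxe => //; apply: emeasurable_funM; last exact: measurable_cst.
by apply/measurable_EFinP; apply: measurable_indic; exact: measurable_cube.
Qed.

Lemma measurable_maxop w f : measurable_fun setT (maxop w f).
Proof. by apply: measurable_ereal_sup => n; exact: measurable_maxop_n. Qed.

Lemma maxop_ge0 w f x : 0 <= maxop w f x.
Proof. by apply: ereal_sup_range_ge0 => n; exact: pmaxe_ge0. Qed.

Lemma maxop_ub w f i x : Q i x -> avgw w f i <= maxop w f x.
Proof.
move=> Qx; apply: (@le_trans _ _ (maxop_n w f i.+1 x)).
  apply: le_trans (pmaxe_ub _ (ltnSn i)).
  by rewrite indicE mem_set// mul1e.
by apply: ereal_sup_ubound; exists i.+1.
Qed.

Lemma maxop_le w f x (y : \bar R) : 0 <= y ->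
  (forall i, Q i x -> avgw w f i <= y) -> maxop w f x <= y.
Proof.
move=> y0 fy; apply: ge_ereal_sup => _ [n _ <-]; apply: pmaxe_le => // i.
rewrite indicE; have [Qx|Qx] := boolP (x \in Q i); last by rewrite mul0e.
by rewrite mul1e; apply: fy; rewrite inE in Qx.
Qed.

(** If [2 E y <= g] the first term dominates, otherwise the second does. The factor 1/2 allows the
    integral of g^p to be absorbed into the left-hand side. *)
Lemma absorb (E p g : R) (y : \bar R) : (0 < E)%R -> (1 < p)%R -> (0 <= g)%R ->
  0 <= y ->
  E%:E * ((g `^ (p - 1))%:E * y) <=
  (2^-1 * g `^ p)%:E + ((2 * E) `^ p)%:E * y `^ p.
Proof.
move=> E0 p1 g0; have p0 : (0 < p)%R by lra.
have p10 : (0 <= p - 1)%R by lra.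
have E20 : (0 < (2 * E) `^ p)%R by rewrite powR_gt0// mulr_gt0.
case: y => [y| |] // y0; last first.
  by rewrite poweRyr ?gt_eqF// [X in _ + X]gt0_muley ?lte_fin// addey// leey.
rewrite lee_fin in y0; rewrite poweR_EFin -!EFinM -EFinD lee_fin.
rewrite -powRM ?mulr_ge0 ?(ltW E0)//.
have gp0 := powR_ge0 g (p - 1).
have [h|/ltW h] := leP (2 * E * y)%R g.
  rewrite -[leLHS]addr0; apply: lerD; last exact: powR_ge0.
  rewrite -(@mulr_powRB1 _ g p)// [leLHS](_ : _ = g `^ (p - 1) * (E * y))%R; last by ring.
  rewrite [leRHS](_ : _ = g `^ (p - 1) * (2^-1 * g))%R; last by ring.
  by apply: ler_wpM2l => //; lra.
rewrite -[leLHS]add0r; apply: lerD; first by rewrite mulr_ge0 ?powR_ge0// invr_ge0.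
have Ey : (0 <= 2 * E * y)%R by rewrite !mulr_ge0// ltW.
rewrite -(@mulr_powRB1 _ (2 * E * y) p)//.
rewrite [leLHS](_ : _ = (E * y) * g `^ (p - 1))%R; last by ring.
apply: ler_pM => //; [by rewrite mulr_ge0// ltW| |].
  by have : (0 <= E * y)%R by [rewrite mulr_ge0// ltW]; lra.
by apply: ge0_ler_powR => //; rewrite nnegrE.
Qed.

Lemma finite_maximal_bound w f (C p : R) (c : nat -> R) n :
  locally_finite_weight w -> doubling w C -> (0 < C)%R -> (1 < p)%R ->
  measurable_fun setT f -> (forall x, 0 <= f x) ->
  (forall i, (0 <= c i)%R) ->
  (forall i, (c i * wcube w (a i) (l i))%:E =
     \int[mu]_(x in Q i) (f x * (w x)%:E)) ->
  \int[mu]_x ((pmaxr (fun i => \1_(Q i) x * c i)%R n `^ p)%:E * (w x)%:E) <=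
  (2 * (2 * (p / (p - 1) * C)) `^ p)%:E * \int[mu]_x (f x `^ p * (w x)%:E).
Proof.
move=> lw dw C0 p1 mf f0 c0 cf; have [mw w0 wfin] := lw.
have p0 : (0 < p)%R by lra.
have p10 : (0 < p - 1)%R by lra.
set E := (p / (p - 1) * C)%R.
have E0 : (0 < E)%R by rewrite mulr_gt0// divr_gt0.
have mEw : measurable_fun setT (EFin \o w) by exact/measurable_EFinP.
have Ew0 x : 0 <= (w x)%:E by rewrite lee_fin ltW.
pose cc x i := (\1_(Q i) x * c i)%R.
pose g x := pmaxr (cc x) n.
have mQ i : measurable (Q i) by exact: measurable_cube.
have mg k : measurable_fun setT (fun x => pmaxr (cc x) k).
  elim: k => [|k IH] /=; first exact: measurable_cst.
  apply: measurable_maxr => //; apply: measurable_funM; last exact: measurable_cst.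
  exact: measurable_indic.
have g0 x : (0 <= g x)%R by exact: pmaxr_ge0.
(* Every value of [g] is 0 or one of the averages [c i], so these are all the levels. *)
pose s := sort <=%R (map c (iota 0 n)).
have s0 : path <=%R 0%R s.
  rewrite (path_sortedE le_trans); apply/andP; split.
    by rewrite all_sort; apply/allP => _ /mapP[i _ ->].
  by apply: sort_sorted; exact: le_total.
have gs x : g x \in 0%R :: s.
  have := pmaxr_mem (cc x) n; rewrite !inE mem_sort => /orP[->//|/mapP[i ii e]].
  rewrite -/(g x) in e; move: e; rewrite /cc indicE.
  case: (x \in Q i); last by rewrite mul0r => ->; rewrite eqxx.
  by rewrite mul1r => ->; rewrite map_f ?orbT.
have mfw : measurable_fun setT (fun x => f x * (w x)%:E) by exact: emeasurable_funM.
have fw0 x : 0 <= f x * (w x)%:E by rewrite mule_ge0.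
have mgp r : measurable_fun setT (fun x => (g x `^ r)%:E).
  by apply/measurable_EFinP; exact: measurableT_comp (measurable_powR r) (mg n).
have mfp : measurable_fun setT (fun x => f x `^ p).
  exact: measurableT_comp (measurable_poweR p) mf.
have H : \int[mu]_x ((g x `^ p)%:E * (w x)%:E) <=
    (p / (p - 1))%:E * \int[mu]_x ((g x `^ (p - 1))%:E * (C%:E * (f x * (w x)%:E))).
  apply: (doob_layers p1 (mg n) s0 gs) => //.
  - by apply: emeasurable_funM.
  - by move=> x; rewrite mule_ge0// lee_fin ltW.
  - move=> e e0.
    (* For [e > 0] a superlevel set of [g] is the union of the cubes whose average is at least [e],
       the situation of [weak_type]. *)
    have -> : [set x | (e <= g x)%R] =
        \big[setU/set0]_(i <- [seq i <- iota 0 n | (e <= c i)%R]) Q i.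
      rewrite -bigcup_seq; apply/seteqP; split=> x /=.
        move/(pmaxr_ge _ _ e0) => [i i_n]; rewrite /cc indicE.
        have [Qx|] := boolP (x \in Q i); last by rewrite mul0r leNgt e0.
        rewrite mul1r => eci; exists i; last by rewrite inE in Qx.
        by rewrite /= mem_filter eci mem_iota.
      move=> [i /=]; rewrite mem_filter mem_iota add0n /= => /andP[eci i_n] Qx.
      apply/(pmaxr_ge _ _ e0); exists i => //.
      by rewrite /cc indicE mem_set// mul1r.
    apply: weak_type => //; first exact: ltW.
    move=> i; rewrite mem_filter => /andP[eci _]; rewrite -cf lee_fin.
    by apply: ler_wpM2r => //; rewrite ltW// wcube_gt0.
(* Absorption subtracts half of the left-hand integral, which must therefore be finite: each new
   cube adds at most [c k ^ p] times its finite measure. *)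
have gfin k : \int[mu]_x ((pmaxr (cc x) k `^ p)%:E * (w x)%:E) < +oo.
  have mk j : measurable_fun setT (fun x => (pmaxr (cc x) j `^ p)%:E * (w x)%:E).
    apply: emeasurable_funM => //; apply/measurable_EFinP.
    exact: measurableT_comp (measurable_powR p) (mg j).
  have k0 j x : 0 <= (pmaxr (cc x) j `^ p)%:E * (w x)%:E.
    by rewrite mule_ge0// lee_fin powR_ge0.
  elim: k => [|k IH] /=.
    by under eq_integral do rewrite powR0 ?gt_eqF// mul0e; rewrite integral0.
  apply: (@le_lt_trans _ _ (\int[mu]_x ((pmaxr (cc x) k `^ p)%:E * (w x)%:E +
      (c k `^ p)%:E * ((EFin \o w) \_ (Q k)) x))).
    have mp : measurable_fun setT ((EFin \o w) \_ (Q k)).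
      by apply/(measurable_restrictT _ (mQ k)); exact: measurable_funTS.
    apply: ge0_le_integral => //.
    - by move=> x _; exact: (k0 k.+1 x).
    - exact: (mk k.+1).
    - by apply: emeasurable_funD => //; apply: emeasurable_funM.
    - move=> x _; rewrite patchE /cc indicE.
      case: (x \in Q k) => /=; last first.
        by rewrite mul0r mule0 adde0 max_l// pmaxr_ge0.
      rewrite mul1r -ge0_muleDl ?lee_fin ?powR_ge0//.
      apply: ler_wpM2r; first exact: ltW.
      by case: (leP (pmaxr _ k) (c k)) => _; rewrite ?lerDl ?lerDr powR_ge0.
  rewrite ge0_integralD//; last 2 first.
  - move=> x _; rewrite patchE; case: ifP => _; last by rewrite mule0.
    by apply: mule_ge0; [rewrite lee_fin powR_ge0|exact: Ew0].
  - apply: emeasurable_funM => //; apply/(measurable_restrictT _ (mQ k)).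
    exact: measurable_funTS.
  rewrite lte_add_pinfty//.
  rewrite ge0_integralZl_EFin ?powR_ge0//.
  - rewrite -integral_mkcond lte_mul_pinfty// ?lee_fin ?powR_ge0//; exact: wfin.
  - by move=> x _; rewrite patchE; case: ifP => // _; exact: Ew0.
  - apply/(measurable_restrictT _ (mQ k)); exact: measurable_funTS.
set Y := \int[mu]_x ((g x `^ p)%:E * (w x)%:E) in H *.
set X := \int[mu]_x (f x `^ p * (w x)%:E).
have Y0 : 0 <= Y by apply: integral_ge0 => x _; rewrite mule_ge0// lee_fin powR_ge0.
have X0 : 0 <= X by apply: integral_ge0 => x _; rewrite mule_ge0// poweR_ge0.
have YX : Y <= (2^-1)%:E * Y + ((2 * E) `^ p)%:E * X.
  apply: (le_trans H); rewrite -ge0_integralZl_EFin//; last 3 first.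
  - by move=> x _; rewrite mule_ge0// ?lee_fin ?powR_ge0// mule_ge0// lee_fin ltW.
  - by apply: emeasurable_funM => //; apply: emeasurable_funM.
  - by rewrite divr_ge0// ltW.
  have -> : ((2 * E) `^ p)%:E * X =
      \int[mu]_x (((2 * E) `^ p)%:E * (f x `^ p * (w x)%:E)).
    rewrite ge0_integralZl_EFin ?powR_ge0//; last exact: emeasurable_funM.
    by move=> x _; rewrite mule_ge0// poweR_ge0.
  have -> : (2^-1)%:E * Y = \int[mu]_x ((2^-1)%:E * ((g x `^ p)%:E * (w x)%:E)).
    rewrite ge0_integralZl_EFin//; last exact: emeasurable_funM.
    by move=> x _; rewrite mule_ge0// lee_fin powR_ge0.
  rewrite -ge0_integralD//; [|nneg|meas|nneg|meas].
  apply: ge0_le_integral => //; [nneg|meas|meas|].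
  - move=> x _; rewrite !muleA -ge0_muleDl; [|nneg|nneg].
    apply: lee_wpmul2r => //.
    rewrite [leLHS](_ : _ = E%:E * ((g x `^ (p - 1))%:E * f x)); last first.
      by rewrite /E (EFinM (p / (p - 1))%R) -!muleA; congr (_ * _); rewrite muleCA.
    by rewrite -EFinM; exact: absorb.
have Yfin : Y \is a fin_num by rewrite ge0_fin_numE//; exact: gfin.
have E20 : (0 < (2 * E) `^ p)%R by rewrite powR_gt0// mulr_gt0.
move: X0 YX; case: X => [X| |] // X0; last first.
  by move=> _; rewrite gt0_muley ?leey// lte_fin mulr_gt0.
rewrite -(fineK Yfin) -!EFinM -EFinD !lee_fin => YX.
lra.
Qed.

End maximal.

Section powers_inverse.
Context {R : realType}.

Lemma powR_pred (x p : R) : 0 < x -> x `^ (p - 1) = x `^ p / x.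
Proof.
move=> x0; rewrite powRB; first by rewrite powRr1 ?ltW.
by apply/implyP => _; rewrite gt_eqF.
Qed.

Lemma powRV (x r : R) : 0 <= x -> x^-1 `^ r = (x `^ r)^-1.
Proof. by move=> x0; rewrite -powR_inv1// -powRrM mulN1r powRN. Qed.

End powers_inverse.

Lemma integral_cube_cst (R : realType) d (a : 'rV[R]_d) (l : R) (c : \bar R) :
  0 < l -> (\int[lebesgue_rV R d]_(x in cube a l) c = c * (l ^+ d)%:E)%E.
Proof.
move=> l0; rewrite (integral_cst _ (measurable_cube a l)).
by congr (_ * _)%E; exact: lebesgue_rV_cube.
Qed.

Section maximal_bound.
Context (R : realType) (d : nat) (a : nat -> 'rV[R]_d) (l : nat -> R).
Hypothesis l0 : forall i, (0 < l i)%R.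
Local Open Scope ereal_scope.
Local Notation mu := (lebesgue_rV R d).
Implicit Types (w : 'rV[R]_d -> R) (f g : 'rV[R]_d -> \bar R).

Lemma maximal_bound w f (C p : R) :
  locally_finite_weight w -> doubling w C -> (0 < C)%R -> (1 < p)%R ->
  measurable_fun setT f -> (forall x, 0 <= f x) ->
  \int[mu]_x (maxop a l w f x `^ p * (w x)%:E) <=
  (2 * (2 * (p / (p - 1) * C)) `^ p)%:E * \int[mu]_x (f x `^ p * (w x)%:E).
Proof.
move=> lw dw C0 p1 mf f0; have [mw w0 wfin] := lw.
have p0 : (0 < p)%R by lra.
have E0 : (0 < 2 * (2 * (p / (p - 1) * C)) `^ p)%R.
  by rewrite mulr_gt0// powR_gt0// mulr_gt0// mulr_gt0// divr_gt0//; lra.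
have [Xy|Xfin] := eqVneq (\int[mu]_x (f x `^ p * (w x)%:E)) +oo.
  by rewrite Xy gt0_muley ?leey.
have {}Xfin : \int[mu]_x (f x `^ p * (w x)%:E) < +oo.
  by rewrite ltey.
have mQ i : measurable (cube (a i) (l i)) by exact: measurable_cube.
(* On a cube t <= 1 + t^p, so the average of [f] is finite by local finiteness of [w] and the
   finiteness of the right-hand side. *)
have Ifin i : \int[mu]_(x in cube (a i) (l i)) (f x * (w x)%:E) < +oo.
  apply: (@le_lt_trans _ _ (\int[mu]_(x in cube (a i) (l i)) (w x)%:E +
      \int[mu]_(x in cube (a i) (l i)) (f x `^ p * (w x)%:E))).
    rewrite -ge0_integralD//; [|nneg|meas|nneg|meas].
    apply: ge0_le_integral => //; [nneg|meas| |].
      by apply: measurable_funTS; meas.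
    move=> x _; rewrite -[X in X + _]mul1e -ge0_muleDl; [|nneg|nneg].
    apply: lee_wpmul2r; first nneg.
    move: (f x) (f0 x) => [r| |]// r0; last by rewrite poweRyr ?gt_eqF// addey// leey.
    rewrite poweR_EFin -EFinD lee_fin; rewrite lee_fin in r0.
    have [r1|/ltW r1] := leP r 1%R; first by rewrite (le_trans r1)// lerDl powR_ge0.
    rewrite -[leLHS]add0r lerD// -[leLHS]powRr1//; apply: ler_powR => //; exact: ltW.
  rewrite lte_add_pinfty//; first exact: wfin.
  apply: le_lt_trans Xfin; apply: ge0_subset_integral => //; [meas|nneg].
have Afin i : avgw a l w f i \is a fin_num.
  apply: fin_numM => //; rewrite ge0_fin_numE//; nneg.
pose c i := fine (avgw a l w f i).
apply: (integral_poweR_sup_le p0 mw w0) => //.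
- by move=> n; exact: measurable_maxop_n.
- by move=> n x; exact: pmaxe_ge0.
- by move=> x; exact: pmaxe_nd.
move=> n; rewrite (eq_integral (fun x => (pmaxr (fun i =>
    \1_(cube (a i) (l i)) x * c i)%R n `^ p)%:E * (w x)%:E)); last first.
  move=> x _; congr (_ * _); rewrite -poweR_EFin -pmaxe_EFin; congr (_ `^ _).
  rewrite /maxop_n; congr pmaxe; apply/funext => i.
  by rewrite EFinM fineK.
apply: finite_maximal_bound => //.
  by move=> i; rewrite fine_ge0//; exact: avgw_ge0.
move=> i; rewrite EFinM fineK// /avgw -muleA -EFinM mulVf ?mule1//.
by rewrite gt_eqF// wcube_gt0.
Qed.

End maximal_bound.

(** * The A_p condition for positive weights: duality and doubling *)

Section Ap_weights.
Context (R : realType) (d : nat).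
Local Open Scope ereal_scope.
Local Notation mu := (lebesgue_rV R d).
Implicit Types (w : 'rV[R]_d -> R) (f g : 'rV[R]_d -> \bar R).

(** The exponent is 1 - p'. *)
Definition dualw (p : R) w x : R := (w x `^ (- (p - 1)^-1))%R.

(** The A_p inequality with its denominators cleared: w(Q) s(Q)^(p-1) <= K |Q|^p, where s is the
    dual weight. *)
Definition Apw (p K : R) w := [/\ locally_finite_weight w,
  locally_finite_weight (dualw p w) &
  forall a l, (0 < l)%R ->
    (wcube w a l * wcube (dualw p w) a l `^ (p - 1) <= K * (l ^+ d) `^ p)%R].

Lemma dualwK p w : (1 < p)%R -> (forall x, 0 < w x)%R ->
  dualw (p / (p - 1)) (dualw p w) = w.
Proof.
move=> p1 w0; apply/funext => x; rewrite /dualw -powRrM.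
have p1N0 : (p - 1 != 0)%R by rewrite gt_eqF// subr_gt0.
rewrite (_ : (- (p - 1)^-1 * - (p / (p - 1) - 1)^-1 = 1)%R) ?powRr1 ?ltW//.
have -> : (p / (p - 1) - 1 = (p - 1)^-1)%R by field.
by rewrite invrK mulrNN mulVf.
Qed.

Lemma Apw_gt0 p K w : Apw p K w -> (0 < K)%R.
Proof.
move=> [lw ls wK]; have := wK 0%R 1%R ltr01; rewrite expr1n powR1 mulr1.
apply: lt_le_trans; apply: mulr_gt0; last apply: powR_gt0; exact: wcube_gt0.
Qed.

(** Since p' - 1 = 1 / (p - 1), raising the A_p inequality to this power exchanges the weight and
    its dual. *)
Lemma Apw_dual p K w : (1 < p)%R -> Apw p K w ->
  Apw (p / (p - 1)) (K `^ (p - 1)^-1) (dualw p w).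
Proof.
move=> p1 wA; have K0 := Apw_gt0 wA; case: wA => lw ls wK.
have w0 : forall x, (0 < w x)%R by case: lw.
have p10 : (0 < p - 1)%R by lra.
have p1N0 : (p - 1 != 0)%R by rewrite gt_eqF.
split; [exact: ls|by rewrite dualwK|move=> a l l0; rewrite dualwK//].
have -> : (p / (p - 1) - 1 = (p - 1)^-1)%R by field.
have W0 := wcube_gt0 a lw l0; have S0 := wcube_gt0 a ls l0.
set W := wcube w a l in W0 *; set S := wcube _ a l in S0 *.
have -> : (S * W `^ (p - 1)^-1 = (W * S `^ (p - 1)) `^ (p - 1)^-1)%R.
  rewrite (powRM _ (ltW W0) (powR_ge0 _ _)) -powRrM divff//.
  by rewrite (powRr1 (ltW S0)) mulrC.
have -> : (K `^ (p - 1)^-1 * (l ^+ d) `^ (p / (p - 1)) =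
    (K * (l ^+ d) `^ p) `^ (p - 1)^-1)%R.
  by rewrite (powRM _ (ltW K0) (powR_ge0 _ _)) -powRrM.
apply: ge0_ler_powR; [by rewrite invr_ge0 ltW| | |exact: wK].
- by rewrite nnegrE ltW// mulr_gt0// powR_gt0.
- by rewrite nnegrE ltW// mulr_gt0// powR_gt0// exprn_gt0.
Qed.

(** Hoelder would give |Q|^p <= w(Q) s(Q)^(p-1). Instead 1 <= t w + (t w)^(-1/(p-1)) holds
    pointwise, as one of the two terms is at least 1. Integrating bounds s(3Q) from below, and the
    A_p inequality on 3Q then bounds w(3Q). *)
Lemma Apw_doubling p K w : (1 < p)%R -> Apw p K w ->
  doubling w (2 `^ p * K * (3 ^+ d) `^ p)%R.
Proof.
move=> p1 wA; have K0 := Apw_gt0 wA; case: wA => lw ls wK a l l0.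
have [mw w0 _] := lw; have [ms s0 _] := ls.
have p10 : (0 < p - 1)%R by lra.
have p1N0 : (p - 1 != 0)%R by rewrite gt_eqF.
have l30 : (0 < 3 * l)%R by rewrite mulr_gt0.
set a' := (a - const_mx l)%R.
have A0 := wcube_gt0 a lw l0; have A'0 := wcube_gt0 a' lw l30.
have S'0 := wcube_gt0 a' ls l30; have H := wK a' _ l30.
set A := wcube w a l in A0 *; set A' := wcube w a' _ in H A'0 *.
set S' := wcube _ a' _ in H S'0 *; set L := (l ^+ d)%R.
have L0 : (0 < L)%R by rewrite exprn_gt0.
rewrite exprMn powRM ?exprn_ge0 ?(ltW l0)// -/L in H.
have mQ b r : measurable (cube b r : set 'rV[R]_d) by exact: measurable_cube.
(* This [t] makes t w integrate to |Q| / 2 over Q, so the dual term accounts for the other half. *)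
pose t := (L / (2 * A))%R; have t0 : (0 < t)%R by rewrite divr_gt0// mulr_gt0.
pose r := (p - 1)^-1%R; have r0 : (0 < r)%R by rewrite invr_gt0.
have pt x : (1 <= t * w x + t `^ (- r) * dualw p w x)%R.
  have twx : (0 < t * w x)%R by rewrite mulr_gt0.
  have -> : (t `^ (- r) * dualw p w x = (t * w x) `^ (- r))%R.
    by rewrite (@powRM _ t (w x)) ?(ltW t0) ?(ltW (w0 x)).
  have [h|h] := leP 1%R (t * w x)%R; first by rewrite (le_trans h)// lerDl powR_ge0.
  rewrite -[leLHS]add0r lerD ?(ltW twx)// powRN invf_ge1 ?powR_gt0//.
  have <- : (1 `^ r = 1 :> R)%R by rewrite powR1.
  by apply: ge0_ler_powR; rewrite ?nnegrE ?ler01 ?(ltW r0) ?(ltW twx) ?(ltW h)//.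
have LS : (L <= t * A + t `^ (- r) * S')%R.
  rewrite -lee_fin.
  apply: (@le_trans _ _ (\int[mu]_(x in cube a l) (t%:E * (w x)%:E +
      (t `^ (- r))%:E * (dualw p w x)%:E))).
    have -> : L%:E = \int[mu]_(x in cube a l) 1 by rewrite integral_cube_cst// mul1e.
    apply: ge0_le_integral; [exact: mQ|nneg|meas|meas|].
    by move=> x _; rewrite -!EFinM -EFinD lee_fin.
  rewrite ge0_integralD//; [|nneg|meas|nneg|meas].
  rewrite ge0_integralZl_EFin//; [|nneg|meas|nneg_real].
  rewrite ge0_integralZl_EFin//; [|nneg|meas|nneg_real].
  rewrite wcubeE// -/A EFinD !EFinM; apply: leeD => //.
  apply: lee_wpmul2l; first nneg.
  rewrite /S' -wcubeE//; apply: ge0_subset_integral => //; [meas|nneg|].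
  by apply: cube_sub_expand; exact: ltW.
have tA : (t * A = L / 2)%R by rewrite /t; field; rewrite gt_eqF.
have {}LS : (L / 2 <= t `^ (- r) * S')%R by move: LS; rewrite tA; lra.
have L20 : (0 < L / 2)%R by rewrite divr_gt0.
have {}LS : ((L / 2) `^ (p - 1) <= t^-1 * S' `^ (p - 1))%R.
  have -> : (t^-1 * S' `^ (p - 1) = (t `^ (- r) * S') `^ (p - 1))%R.
    rewrite powRM ?powR_ge0 ?ltW// -powRrM mulNr /r mulVf//.
    by rewrite powR_inv1// ltW.
  apply: ge0_ler_powR => //; rewrite ?nnegrE; first exact: ltW.
    exact: ltW.
  by rewrite mulr_ge0 ?powR_ge0// ltW.
have E1 : (A' * (L / 2) `^ (p - 1) <= t^-1 * (K * ((3 ^+ d) `^ p * L `^ p)))%R.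
  apply: (@le_trans _ _ (t^-1 * (A' * S' `^ (p - 1)))%R).
    by rewrite mulrCA; apply: ler_wpM2l => //; exact: ltW.
  by apply: ler_wpM2l => //; rewrite invr_ge0 ltW.
have P2 : (0 < (2 : R) `^ p)%R by rewrite powR_gt0.
have Lp : (0 < L `^ p)%R by rewrite powR_gt0.
have L2E : ((L / 2) `^ (p - 1) = L `^ p / 2 `^ p / (L / 2))%R.
  by rewrite powR_pred// powRM ?ltW// ?powRV// invr_ge0.
have F0 : (0 <= 2 `^ p * L / (2 * L `^ p))%R by nneg_real.
have := ler_wpM2r F0 E1; rewrite L2E /t => E2.
have -> : (A' = A' * (L `^ p / 2 `^ p / (L / 2)) * (2 `^ p * L / (2 * L `^ p)))%R.
  by field; rewrite !gt_eqF.
apply: (le_trans E2); rewrite le_eqVlt; apply/orP; left; apply/eqP.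
by field; rewrite !gt_eqF.
Qed.

End Ap_weights.

(** * Muckenhoupt's theorem with a constant uniform over the A_p class *)

Section Muckenhoupt.
Context (R : realType) (d : nat) (a : nat -> 'rV[R]_d) (l : nat -> R).
Hypothesis l0 : forall i, (0 < l i)%R.
Local Open Scope ereal_scope.
Local Notation mu := (lebesgue_rV R d).
Implicit Types (w : 'rV[R]_d -> R) (f g : 'rV[R]_d -> \bar R).

Lemma wcube1 (b : 'rV[R]_d) (r : R) : (0 < r)%R -> wcube (cst 1%R) b r = (r ^+ d)%R.
Proof.
move=> r0; by rewrite /wcube /cst /= integral_cube_cst// mul1e.
Qed.

Lemma locally_finite_weight1 : locally_finite_weight (cst 1%R : 'rV[R]_d -> R).
Proof.
split=> //; move=> b r r0; by rewrite /cst /= integral_cube_cst// mul1e ltry.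
Qed.

Lemma Apw_weighted_maximal_bound (p q K : R) : (1 < p)%R -> (1 < q)%R ->
  (0 < K)%R -> exists2 B : R, (0 < B)%R &
  forall w f, Apw p K w -> measurable_fun setT f -> (forall x, 0 <= f x) ->
  \int[mu]_x (maxop a l w f x `^ q * (w x)%:E) <=
  B%:E * \int[mu]_x (f x `^ q * (w x)%:E).
Proof.
move=> p1 q1 K0.
have D0 : (0 < 2 `^ p * K * (3 ^+ d) `^ p)%R.
  by rewrite mulr_gt0 ?powR_gt0 ?exprn_gt0// mulr_gt0// powR_gt0.
exists (2 * (2 * (q / (q - 1) * (2 `^ p * K * (3 ^+ d) `^ p))) `^ q)%R.
  rewrite mulr_gt0// powR_gt0// mulr_gt0// mulr_gt0// divr_gt0//; last first.
    by rewrite subr_gt0.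
  exact: lt_trans q1.
move=> w f wA mf f0; have [lw _ _] := wA.
exact: maximal_bound (Apw_doubling p1 wA) _ _ _ _.
Qed.

(* Lerner's argument: the maximal function of f is dominated by
   M_w(M_s(f / s)^(p - 1) / w)^(1 / (p - 1)) with s the dual weight, and the
   maximal functions M_w, M_s of the weights are bounded on L^p'(w), L^p(s). *)
Lemma Ap_maximal_bound (p K : R) : (1 < p)%R -> exists2 B : R, (0 < B)%R &
  forall w f, Apw p K w -> measurable_fun setT f -> (forall x, 0 <= f x) ->
  \int[mu]_x (maxop a l (cst 1%R) f x `^ p * (w x)%:E) <=
  B%:E * \int[mu]_x (f x `^ p * (w x)%:E).
Proof.
move=> p1; have p0 : (0 < p)%R by lra.
have p10 : (0 < p - 1)%R by lra.
have p1N0 : (p - 1 != 0)%R by rewrite gt_eqF.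
have [K0|K0] := leP K 0%R.
  by exists 1%R => // w f /Apw_gt0; rewrite ltNge K0.
have [p' p'E] : exists p', p' = (p / (p - 1))%R by eexists.
have p'0 : (0 < p')%R by rewrite p'E divr_gt0.
have p'1 : (1 < p')%R by rewrite p'E ltr_pdivlMr//; lra.
have K'0 : (0 < K `^ (p - 1)^-1)%R by rewrite powR_gt0.
have [B1 B10 MB1] := Apw_weighted_maximal_bound p1 p'1 K0.
have [B2 B20 MB2] := Apw_weighted_maximal_bound p'1 p1 K'0.
have Kp0 : (0 < K `^ p')%R by rewrite powR_gt0.
exists (K `^ p' * B1 * B2)%R; first exact: mulr_gt0 (mulr_gt0 Kp0 B10) B20.
move=> w f wA mf f0; have [lw ls wK] := wA.
have [mw w0 _] := lw; have [ms s0 _] := ls.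
set s := dualw p w in ls wK ms s0.
pose phi x := f x * ((s x)^-1)%:E.
pose A := maxop a l s phi.
pose psi x := A x `^ (p - 1) * ((w x)^-1)%:E.
have minv (v : 'rV[R]_d -> R) : measurable_fun setT v -> (forall x, 0 < v x)%R ->
    measurable_fun setT (fun x => ((v x)^-1)%:E).
  move=> mv v0; apply/measurable_EFinP.
  rewrite [X in measurable_fun _ X](_ : _ = fun x => v x `^ (-1))%R.
    exact: measurableT_comp (measurable_powR _) mv.
  by apply/funext => x; rewrite powR_inv1// ltW.
have mphi : measurable_fun setT phi by apply: emeasurable_funM => //; exact: minv.
have phi0 x : 0 <= phi x by rewrite mule_ge0// lee_fin invr_ge0 ltW.
have mA : measurable_fun setT A by exact: measurable_maxop.
have A0 x : 0 <= A x by exact: maxop_ge0.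
have mpsi : measurable_fun setT psi.
  apply: emeasurable_funM; last exact: minv.
  exact: measurableT_comp (measurable_poweR _) mA.
have psi0 x : 0 <= psi x by rewrite mule_ge0 ?poweR_ge0// lee_fin invr_ge0 ltW.
have mQ b r : measurable (cube b r : set 'rV[R]_d) by exact: measurable_cube.
pose P := maxop a l w psi.
have mP : measurable_fun setT P by exact: measurable_maxop.
have P0 x : 0 <= P x by exact: maxop_ge0.
have key x : maxop a l (cst 1%R) f x <= (K%:E * P x) `^ (p - 1)^-1.
  apply: maxop_le => [|i Qx]; first exact: poweR_ge0.
  have KP0 : 0 <= K%:E * P x by nneg.
  rewrite -poweR_le_inv//; last exact: avgw_ge0 locally_finite_weight1 f0.
  have W0 := wcube_gt0 (a i) lw (l0 i); have S0 := wcube_gt0 (a i) ls (l0 i).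
  have WSL := wK (a i) (l i) (l0 i).
  apply: le_trans (lee_wpmul2l _ (maxop_ub w psi Qx)); last by rewrite lee_fin ltW.
  rewrite /avgw wcube1//.
  set W := wcube w _ _ in WSL W0 *; set S := wcube s _ _ in WSL S0 *.
  set L := (l i ^+ d)%R in WSL *.
  have L0 : (0 < L)%R by rewrite exprn_gt0.
  rewrite (eq_integral f); last by move=> y _; rewrite mule1.
  have -> : \int[mu]_(x0 in cube (a i) (l i)) (psi x0 * (w x0)%:E) =
      \int[mu]_(x0 in cube (a i) (l i)) (A x0 `^ (p - 1)).
    apply: eq_integral => y _; rewrite /psi -muleA -EFinM mulVf ?mule1//.
    by rewrite gt_eqF.
  set I := integral _ _ _.
  have I0 : 0 <= I by apply: integral_ge0.
  (* The s-average of f / s over the cube is the integral of f divided by s(Q), so [A] is at least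
     this number on the whole cube. *)
  have IS y : cube (a i) (l i) y -> I * (S^-1)%:E <= A y.
    move=> Qy; apply: le_trans (maxop_ub s phi Qy); rewrite /avgw -/S.
    rewrite /phi; under [X in _ <= X * _]eq_integral do
      rewrite -muleA -EFinM mulVf ?mule1 ?gt_eqF//.
    by [].
  have IA : (I * (S^-1)%:E) `^ (p - 1) * L%:E <=
      \int[mu]_(x0 in cube (a i) (l i)) (A x0 `^ (p - 1)).
    rewrite -(integral_cube_cst (a i))//.
    apply: ge0_le_integral; [exact: mQ|nneg|meas|meas|].
    move=> y Qy; apply: le_poweR; first exact: ltW.
      by rewrite mule_ge0// lee_fin invr_ge0 ltW.
    exact: IS.
  apply: (@le_trans _ _ (K%:E * ((I * (S^-1)%:E) `^ (p - 1) * L%:E * (W^-1)%:E))); last first.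
    apply: lee_wpmul2l; first nneg.
    by apply: lee_wpmul2r => //; rewrite lee_fin invr_ge0 ltW.
  (* What remains is (I / L)^(p-1) <= K (I / S)^(p-1) L / W, which is the A_p inequality W S^(p-1)
     <= K L^p. *)
  rewrite !poweRM ?lee_fin ?invr_ge0 ?(ltW L0) ?(ltW S0)// !poweR_EFin.
  rewrite [leRHS](_ : _ = I `^ (p - 1) * (K * (S^-1 `^ (p - 1) * L * W^-1))%:E); last first.
    by rewrite !EFinM -!muleA [LHS]muleCA.
  apply: lee_wpmul2l; first exact: poweR_ge0.
  rewrite lee_fin.
  have -> : (L^-1 `^ (p - 1) = L * (L `^ p)^-1)%R.
    by rewrite powRV ?ltW// powR_pred// invf_div.
  rewrite (powRV _ (ltW S0)).
  have Lp : (0 < L `^ p)%R by rewrite powR_gt0.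
  have Sp : (0 < S `^ (p - 1))%R by rewrite powR_gt0.
  rewrite [leRHS](_ : _ = L * (K / (W * S `^ (p - 1))))%R; last first.
    by field; rewrite !gt_eqF.
  apply: ler_wpM2l; first exact: ltW.
  rewrite ler_pdivlMr ?mulr_gt0// mulrC ler_pdivrMr//.
have pp' : ((p - 1) * p' = p)%R by rewrite p'E mulrC divfK.
apply: (@le_trans _ _ (\int[mu]_x ((K `^ p')%:E * (P x `^ p' * (w x)%:E)))).
  apply: ge0_le_integral; [by []|nneg| |meas|].
    apply: emeasurable_funM; last meas.
    exact: measurableT_comp (measurable_poweR _) (measurable_maxop _ _ _ _).
  move=> x _; rewrite muleA; apply: lee_wpmul2r; first nneg.
  rewrite -poweR_EFin -poweRM//; last by rewrite lee_fin ltW.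
  rewrite p'E mulrC poweRrM; apply: le_poweR => //; [exact: ltW|exact: maxop_ge0].
rewrite ge0_integralZl_EFin//; [|nneg|meas|nneg_real].
rewrite -mulrA EFinM -muleA; apply: lee_wpmul2l; first nneg.
have sA : Apw p' (K `^ (p - 1)^-1) s by rewrite p'E; exact: Apw_dual.
apply: (le_trans (MB1 _ _ wA mpsi psi0)).
rewrite (EFinM B1) -muleA; apply: lee_wpmul2l; first nneg.
(* Here (p - 1) p' = p and w^(-p') w = w^(1-p') = s. *)
have -> : \int[mu]_x (psi x `^ p' * (w x)%:E) = \int[mu]_x (A x `^ p * (s x)%:E).
  apply: eq_integral => x _; rewrite /psi poweRM ?poweR_ge0//; last first.
    by rewrite lee_fin invr_ge0 ltW.
  rewrite -poweRrM pp' -muleA; congr (_ * _).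
  rewrite poweR_EFin -EFinM; congr (_%:E).
  rewrite powRV ?ltW// -powRN -[X in (_ * X)%R]powRr1 ?ltW// -powRD; last first.
    by apply/implyP => _; rewrite gt_eqF.
  by rewrite /s /dualw; congr (_ `^ _)%R; rewrite p'E; field.
apply: (le_trans (MB2 _ _ sA mphi phi0)).
apply: lee_wpmul2l; first nneg.
(* The integrands agree: phi^p s = f^p s^(1-p) = f^p w. *)
rewrite le_eqVlt; apply/orP; left; apply/eqP.
apply: eq_integral => x _; rewrite /phi poweRM//; last by rewrite lee_fin invr_ge0 ltW.
rewrite -muleA; congr (_ * _); rewrite poweR_EFin -EFinM; congr (_%:E).
rewrite powRV ?ltW// -powRN -[X in (_ * X)%R]powRr1 ?ltW// -powRD; last first.
  by apply/implyP => _; rewrite gt_eqF.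
rewrite /s /dualw -powRrM -[RHS]powRr1 ?ltW//; congr (_ `^ _)%R; by field.
Qed.

End Muckenhoupt.

(** * Rational cubes and a positive integrable function *)

Section rational_cubes.
Context (R : realType) (d : nat).

(** Codes that denote no pair, and nonpositive sides, default to side 1, so every index gives a
    genuine cube. *)
Definition rat_cube (i : nat) : 'rV[R]_d * R :=
  if @unpickle ('rV[rat]_d * rat)%type i is Some (b, r) then
    (map_mx ratr b, if 0 < ratr r :> R then ratr r else 1)
  else (0, 1).

Definition rat_corner i := (rat_cube i).1.
Definition rat_side i := (rat_cube i).2.

Lemma rat_side_gt0 i : 0 < rat_side i.
Proof.
by rewrite /rat_side /rat_cube; case: unpickle => [[b r]|] //=; case: ifP.
Qed.

(** The corner is moved down by less than l/2 and the side exceeds 3l/2, so the upper faces still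
    lie beyond a + l. The bound 2l costs a factor 2^d in the A_1 constant. *)
Lemma rat_cube_cover (a : 'rV[R]_d) (l : R) : 0 < l -> exists i,
  cube a l `<=` cube (rat_corner i) (rat_side i) /\ rat_side i <= 2 * l.
Proof.
move=> l0.
have /choice[b bP] : forall k : 'I_d, exists q : rat,
    ratr q \in `](a ord0 k - l / 2), (a ord0 k)[.
  by move=> k; apply: rat_in_itvoo; lra.
have [r] : exists q : rat, ratr q \in `](3 / 2 * l), (2 * l)[.
  by apply: rat_in_itvoo; lra.
rewrite in_itv/= => /andP[rl lr].
have r0 : 0 < ratr r :> R by lra.
exists (pickle (\row_k b k, r)).
rewrite /rat_corner /rat_side /rat_cube pickleK /= r0; split; last exact: ltW.
move=> x xa k; rewrite !mxE; have := xa k; have := bP k; rewrite in_itv/=.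
by move=> /andP[? ?] /andP[? ?]; apply/andP; split; lra.
Qed.

Local Open Scope ereal_scope.

(** The indicators of the rational cubes are summed with weights 2^-(i+1) / |Q_i|; the sum is
    positive because the cubes cover the space. *)
Lemma positive_integrable : exists e : 'rV[R]_d -> \bar R,
  [/\ measurable_fun setT e, forall x, 0 < e x &
      \int[lebesgue_rV R d]_x e x <= 1].
Proof.
pose Q i := cube (rat_corner i) (rat_side i).
pose c i : R := (1 / (2 ^ i.+1)%:R / rat_side i ^+ d)%R.
have c0 i : (0 < c i)%R.
  by rewrite divr_gt0// ?exprn_gt0 ?rat_side_gt0// divr_gt0// ltr0n expn_gt0.
have mQ i : measurable (Q i) by exact: measurable_cube.
pose t i x : \bar R := (c i)%:E * (\1_(Q i) x)%:E.
have mt i : measurable_fun setT (t i).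
  apply: emeasurable_funM; first exact: measurable_cst.
  by apply/measurable_EFinP; exact: measurable_indic.
have t0 i x : 0 <= t i x by rewrite mule_ge0// lee_fin// ltW.
exists (fun x => \sum_(i <oo) t i x); split.
- exact: (@ge0_emeasurable_sum _ _ _ _ _ predT).
- move=> x; have [i [Qi _]] := rat_cube_cover x ltr01.
  apply: (@lt_le_trans _ _ (t i x)).
    rewrite /t indicE mem_set ?mule1 ?lte_fin//; apply: Qi => k.
    by rewrite lexx/= lerDl.
  apply: le_trans (nneseries_lim_ge i.+1 _) => //.
  by rewrite big_nat_recr//= leeDr// sume_ge0.
- rewrite integral_nneseries//.
  apply: le_trans (epsilon_trick0 predT ler01).
  apply: lee_nneseries => // [i _ _|i _]; first exact: integral_ge0.
  rewrite ge0_integralZl_EFin//; last 2 first.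
  + by apply/measurable_EFinP; exact: measurable_indic.
  + exact: ltW.
  rewrite integral_indic// setIT.
  rewrite [X in _ * X](_ : _ = (rat_side i ^+ d)%:E); last first.
    exact: lebesgue_rV_cube (rat_side_gt0 i).
  rewrite -EFinM lee_fin /c divfK// gt_eqF// exprn_gt0// rat_side_gt0//.
Qed.

End rational_cubes.

(** * A_1 majorants and products of A_1 weights *)

Section A1_weights.
Context (R : realType) (d : nat).
Local Open Scope ereal_scope.
Local Notation mu := (lebesgue_rV R d).
Implicit Types (w H S : 'rV[R]_d -> R) (f g : 'rV[R]_d -> \bar R).

(** The mean of H over Q is at most B H almost everywhere on Q; the exceptional null set may depend
    on the cube. *)
Definition A1w (B : R) H := [/\ measurable_fun setT H, forall x, (0 < H x)%R &
  forall a l, (0 < l)%R -> {ae mu, forall x, cube a l x ->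
    \int[mu]_(y in cube a l) (H y)%:E <= (B * l ^+ d * H x)%:E}].

Lemma maxop_mono (a : nat -> 'rV[R]_d) (l : nat -> R) w f g x :
  (forall i, (0 < l i)%R) -> locally_finite_weight w ->
  measurable_fun setT f -> measurable_fun setT g -> (forall x, 0 <= f x) ->
  (forall x, f x <= g x) -> maxop a l w f x <= maxop a l w g x.
Proof.
move=> l0 lw mf mg f0 fg; have [mw w0 _] := lw.
have g0 y : 0 <= g y by exact: le_trans (fg y).
apply: maxop_le => [|i Qx]; first exact: maxop_ge0.
apply: le_trans (maxop_ub w g Qx); apply: lee_wpmul2r.
  by rewrite lee_fin invr_ge0 ltW// wcube_gt0.
apply: ge0_le_integral; [exact: measurable_cube|nneg|meas|meas|].
by move=> y _; apply: lee_wpmul2r => //; rewrite lee_fin ltW.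
Qed.

(* H is the limit of h_0 = f, h_{n+1} = max(f, c M h_n); with max instead of the
   usual series the L^p bound needs no Minkowski inequality. *)
Lemma rubio_de_francia (p K : R) : (1 < p)%R -> exists2 B : R, (0 < B)%R &
  forall w f, Apw p K w -> measurable_fun setT f -> (forall x, 0 < f x) ->
  \int[mu]_x (f x `^ p * (w x)%:E) < +oo ->
  exists H, [/\ A1w B H, {ae mu, forall x, f x <= (H x)%:E} &
    \int[mu]_x ((H x)%:E `^ p * (w x)%:E) <=
    2%:E * \int[mu]_x (f x `^ p * (w x)%:E)].
Proof.
move=> p1; have p0 : (0 < p)%R by lra.
have [B B0 MB] := @Ap_maximal_bound R d (@rat_corner R d) _ (@rat_side_gt0 R d) p K p1.
(* With c^p B = 1/2 the bound 2X reproduces itself along the iteration: X + (1/2) 2X = 2X. *)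
pose c : R := ((2 * B) `^ (- p^-1))%R.
have c0 : (0 < c)%R by rewrite powR_gt0// mulr_gt0.
have cp : (c `^ p * B = 2^-1)%R.
  rewrite /c -powRrM mulNr mulVf ?gt_eqF// powR_inv1 ?mulr_ge0 ?(ltW B0)//.
  by rewrite invfM mulfVK// gt_eqF.
(* 1/c comes from c M H <= H, and 2^d from enlarging a cube to a rational one. *)
exists (2 ^+ d / c)%R; first by rewrite divr_gt0// exprn_gt0.
move=> w f wA mf f0 ffin; have [lw ls wK] := wA; have [mw w0 wfin] := lw.
set X := \int[mu]_x _ in ffin *.
have f0' x : 0 <= f x by exact: ltW.
have X0 : 0 <= X by nneg.
pose M := maxop (@rat_corner R d) (@rat_side R d) (cst 1%R).
have mM g : measurable_fun setT (M g) by exact: measurable_maxop.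
have M0 g x : 0 <= M g x by exact: maxop_ge0.
pose h := fix h n := if n is k.+1 then fun x => maxe (f x) (c%:E * M (h k) x) else f.
have hS n x : h n.+1 x = maxe (f x) (c%:E * M (h n) x) by [].
have mh n : measurable_fun setT (h n).
  elim: n => [//|n IH] /=; apply: measurable_maxe => //.
  by apply: emeasurable_funM => //; exact: mM.
have h0 n x : 0 <= h n x by case: n => [|n] /=; rewrite ?le_max ?f0'.
have hnd1 n x : h n x <= h n.+1 x.
  elim: n x => [|n IH] x; first by rewrite hS le_max lexx.
  rewrite [leLHS]hS [leRHS]hS ge_max !le_max lexx /=; apply/orP; right.
  apply: lee_wpmul2l; first by rewrite lee_fin ltW.
  apply: (maxop_mono _ _ (@rat_side_gt0 R d) (@locally_finite_weight1 R d) (mh n)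
    (mh n.+1) (h0 n)) => y; exact: IH.
have hnd x : {homo h^~ x : n m / (n <= m)%N >-> n <= m}.
  apply: (@homo_leq _ _ (fun x y => x <= y)) => //.
  by move=> y z t; exact: le_trans.
have hX n : \int[mu]_x (h n x `^ p * (w x)%:E) <= 2%:E * X.
  elim: n => [|n IH].
    by rewrite -[leLHS]mul1e; apply: lee_wpmul2r => //; rewrite lee_fin ler1n.
  apply: (@le_trans _ _ (\int[mu]_x (f x `^ p * (w x)%:E +
      (c `^ p)%:E * (M (h n) x `^ p * (w x)%:E)))).
    apply: ge0_le_integral; [by []|nneg|meas|meas|].
    move=> x _; rewrite muleA -ge0_muleDl; [|nneg|nneg].
    apply: lee_wpmul2r; first by rewrite lee_fin ltW.
    rewrite -poweR_EFin -poweRM ?lee_fin ?(ltW c0)// hS.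
    by case: (leP (f x) _) => _; rewrite ?leeDl ?leeDr// poweR_ge0.
  rewrite ge0_integralD; [|by []|nneg|meas|nneg|meas].
  rewrite ge0_integralZl_EFin; [|by []|nneg|meas|nneg_real].
  rewrite -/X; apply: (@le_trans _ _ (X + (c `^ p)%:E * (B%:E * (2%:E * X)))).
    apply: leeD => //; apply: lee_wpmul2l; first nneg.
    apply: le_trans (MB _ _ wA (mh n) (h0 n)) _.
    by apply: lee_wpmul2l => //; rewrite lee_fin ltW.
  rewrite !muleA -!EFinM cp mulVf// mul1e.
  by rewrite -[X in X + _]mul1e -[X in _ + X]mul1e -ge0_muleDl.
pose Hs x := ereal_sup (range (h^~ x)).
have mHs : measurable_fun setT Hs by exact: measurable_ereal_sup.
have hHs n x : h n x <= Hs x by apply: ereal_sup_ubound; exists n.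
have Hs0 x : 0 < Hs x by apply: lt_le_trans (hHs 0%N x).
have Hs0' x : 0 <= Hs x by exact: ltW.
have HsX : \int[mu]_x (Hs x `^ p * (w x)%:E) <= 2%:E * X.
  exact: (integral_poweR_sup_le p0 mw w0 mh h0 hnd hX).
have Hsfin : {ae mu, forall x, Hs x \is a fin_num}.
  have : mu.-integrable setT (fun x => Hs x `^ p * (w x)%:E).
    apply/integrableP; split; first meas.
    rewrite (eq_integral (fun x => Hs x `^ p * (w x)%:E)); last first.
      by move=> x _; rewrite gee0_abs//; nneg.
    by apply: (le_lt_trans HsX); rewrite lte_mul_pinfty.
  move/(integrable_ae measurableT); apply: filterS => x /(_ I).
  rewrite !ge0_fin_numE//; last nneg.
  apply: contraTT; rewrite -!leNgt !leye_eq => /eqP ->.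
  have pN0 : p != 0%R by rewrite gt_eqF.
  by rewrite (poweRyr pN0) gt0_mulye ?lte_fin.
(* The supremum is finite almost everywhere; the value 1 elsewhere keeps [H] real and positive. *)
pose H x : R := if Hs x \is a fin_num then fine (Hs x) else 1%R.
have HHs x : (H x)%:E <= Hs x.
  rewrite /H; case: ifPn => [fx|]; first by rewrite fineK.
  by rewrite ge0_fin_numE// -leNgt leye_eq => /eqP ->; rewrite leey.
have HHsE x : Hs x \is a fin_num -> (H x)%:E = Hs x.
  by move=> fx; rewrite /H fx fineK.
have H0 x : (0 < H x)%R.
  rewrite /H; case: ifPn => // fx; rewrite fine_gt0// Hs0/= ltey_eq fx//.
have mH : measurable_fun setT H.
  apply: measurable_fun_ifT; last exact: measurable_cst.
    apply: (measurable_fun_bool true); rewrite setTI.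
    have := emeasurable_fin_num measurableT mHs; rewrite setTI; congr measurable.
  exact: measurableT_comp (fine_measurable measurableT) mHs.
exists H; split.
- split=> // a l l0; apply: filterS Hsfin => x fx xal.
  have [i [Qi il]] := rat_cube_cover a l0.
  have mQ : measurable (cube (rat_corner R d i) (rat_side R d i)) by exact: measurable_cube.
  have mQ' : measurable (cube a l) by exact: measurable_cube.
  have s0 := rat_side_gt0 R d i.
  apply: (@le_trans _ _ (\int[mu]_(y in cube a l) Hs y)).
    by apply: ge0_le_integral; [exact: mQ'|nneg|meas|meas|].
  apply: (@le_trans _ _ (\int[mu]_(y in cube (rat_corner R d i) (rat_side R d i)) Hs y)).
    by apply: ge0_subset_integral => //; exact: measurable_funTS.
  rewrite integral_ereal_sup//; apply: ge_ereal_sup => _ [n _ <-].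
  (* At a point x of the cube, c times the average of h_n is at most h_{n+1}(x), hence at most the
     supremum; then n tends to infinity. *)
  have := le_trans (lee_wpmul2l (ltW (c0 : 0 < c%:E)) (maxop_ub (cst 1%R) (h n) (Qi x xal))).
  move/(_ (h n.+1 x)); rewrite hS le_max lexx orbT => /(_ isT) /le_trans /(_ (hHs n.+1 x)).
  rewrite -HHsE// /avgw wcube1//.
  rewrite (eq_integral (h n)); last by move=> y _; rewrite mule1.
  rewrite muleCA -EFinM => IH.
  have sd0 : (0 < rat_side R d i ^+ d)%R by rewrite exprn_gt0.
  have cs0 : (0 < c * (rat_side R d i ^+ d)^-1)%R by rewrite divr_gt0.
  move: IH; rewrite -lee_pdivlMr// => /le_trans; apply.
  rewrite -EFinM lee_fin [leRHS]mulrC; apply: ler_wpM2l; first exact: ltW.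
  rewrite invfM invrK [leRHS](_ : _ = c^-1 * (2 * l) ^+ d)%R; last by rewrite exprMn; ring.
  apply: ler_wpM2l; first by rewrite invr_ge0 ltW.
  by apply: lerXn2r => //; rewrite nnegrE ltW// mulr_gt0.
- apply: filterS Hsfin => x fx; rewrite HHsE//; exact: (hHs 0%N).
- apply: le_trans HsX; apply: ge0_le_integral; [by []|nneg|meas|meas|].
  move=> x _; apply: lee_wpmul2r; first nneg.
  by apply: le_poweR => //; rewrite ?lee_fin ltW.
Qed.

Lemma ae_exists (D : set 'rV[R]_d) (P : 'rV[R]_d -> Prop) : measurable D ->
  0 < mu D -> {ae mu, forall x, D x -> P x} -> exists2 x, D x & P x.
Proof.
move=> mD D0 [N [mN N0 DN]]; apply: contrapT => nP.
have : mu D <= mu N.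
  apply: le_measure; rewrite ?inE// => x Dx; apply: DN => /= /(_ Dx) Px.
  by apply: nP; exists x.
by rewrite [mu N]N0 leNgt D0.
Qed.

(** One point of the cube at which the A_1 inequality holds already bounds the integral. *)
Lemma A1w_locally_finite B H : A1w B H -> locally_finite_weight H.
Proof.
move=> [mH H0 HB]; split=> // a l l0.
have D0 : 0 < mu (cube a l) by rewrite lebesgue_rV_cube// lte_fin exprn_gt0.
have [x _] := ae_exists (measurable_cube a l) D0 (HB a l l0).
by move/le_lt_trans; apply; rewrite ltry.
Qed.

Lemma A1w_lower B H a l : (0 < B)%R -> A1w B H -> (0 < l)%R ->
  {ae mu, forall x, cube a l x -> (wcube H a l / (B * l ^+ d) <= H x)%R}.
Proof.
move=> B0 HA l0; have lH := A1w_locally_finite HA; case: HA => mH H0 /(_ a l l0).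
apply: filterS => x Hx /Hx; rewrite wcubeE// lee_fin ler_pdivrMr//.
  by rewrite mulrC.
by rewrite mulr_gt0// exprn_gt0.
Qed.

Lemma ge0_ler_powRN (r x y : R) : (0 <= r)%R -> (0 < x)%R -> (x <= y)%R ->
  (y `^ (- r) <= x `^ (- r))%R.
Proof.
move=> r0 x0 xy; have y0 := lt_le_trans x0 xy.
rewrite !powRN lef_pV2 ?posrE ?powR_gt0//.
by apply: ge0_ler_powR => //; rewrite nnegrE ltW.
Qed.

(** The easy half of Jones factorisation. On a cube H is at least its mean over B1, so H^(1-p) can
    be replaced by a constant; the dual weight is H S^(1-p'), treated in the same way, and the means
    cancel in the product. *)
Lemma A1w_Apw (B1 B2 p : R) H S : (0 < B1)%R -> (0 < B2)%R -> (1 < p)%R ->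
  A1w B1 H -> A1w B2 S ->
  Apw p (B1 `^ (p - 1) * B2)%R (fun x => S x * H x `^ (- (p - 1)))%R.
Proof.
move=> B10 B20 p1 HA SA.
have p10 : (0 < p - 1)%R by lra.
have p1N0 : (p - 1 != 0)%R by rewrite gt_eqF.
pose r := (p - 1)^-1%R; have r0 : (0 < r)%R by rewrite invr_gt0.
have lH := A1w_locally_finite HA; have lS := A1w_locally_finite SA.
have [mH H0 _] := HA; have [mS S0 _] := SA.
pose w x := (S x * H x `^ (- (p - 1)))%R.
have w0 x : (0 < w x)%R by rewrite mulr_gt0// powR_gt0.
have mw : measurable_fun setT w.
  apply: measurable_funM => //.
  exact: measurableT_comp (measurable_powR _) mH.
have sE x : dualw p w x = (H x * S x `^ (- r))%R.
  rewrite /dualw /w powRM ?powR_ge0 ?ltW// mulrC -powRrM mulrNN divff//.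
  by rewrite powRr1// ltW.
have s0 x : (0 < dualw p w x)%R by rewrite powR_gt0.
have ms : measurable_fun setT (dualw p w).
  exact: measurableT_comp (measurable_powR _) mw.
have mQ a l : measurable (cube a l : set 'rV[R]_d) by exact: measurable_cube.
(* Stated for a general pair, to serve for the weight (U = S, V = H) and for its dual (U = H, V =
   S). *)
have key (U V : 'rV[R]_d -> R) (q B : R) a l : (0 < B)%R -> (0 <= q)%R ->
    A1w B V -> locally_finite_weight U -> (0 < l)%R ->
    \int[mu]_(x in cube a l) (U x * V x `^ (- q))%:E <=
    ((wcube V a l / (B * l ^+ d)) `^ (- q) * wcube U a l)%:E.
  move=> B0 q0 VA lU l0; have [mV V0 _] := VA; have [mU U0 _] := lU.
  have lV := A1w_locally_finite VA.
  have h0 : (0 < wcube V a l / (B * l ^+ d))%R.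
    by rewrite divr_gt0 ?wcube_gt0// mulr_gt0// exprn_gt0.
  rewrite EFinM -wcubeE// -ge0_integralZl_EFin; [|exact: mQ|nneg|meas|nneg_real].
  apply: ae_ge0_le_integral; [exact: mQ|nneg|meas|nneg|meas|].
  apply: filterS (A1w_lower a B0 VA l0) => x Vx Qx.
  rewrite -EFinM lee_fin mulrC; apply: ler_wpM2r; first exact: ltW.
  by apply: ge0_ler_powRN => //; exact: Vx.
have keyw a l : (0 < l)%R -> \int[mu]_(x in cube a l) (w x)%:E <=
    ((wcube H a l / (B1 * l ^+ d)) `^ (- (p - 1)) * wcube S a l)%:E.
  by move=> l0; apply: key => //; exact: ltW.
have keys a l : (0 < l)%R -> \int[mu]_(x in cube a l) (dualw p w x)%:E <=
    ((wcube S a l / (B2 * l ^+ d)) `^ (- r) * wcube H a l)%:E.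
  move=> l0; under eq_integral do rewrite sE.
  by apply: key => //; exact: ltW.
have lw : locally_finite_weight w.
  by split=> // a l l0; apply: le_lt_trans (keyw a l l0) _; rewrite ltry.
have ls : locally_finite_weight (dualw p w).
  by split=> // a l l0; apply: le_lt_trans (keys a l l0) _; rewrite ltry.
split=> // a l l0.
have := keyw a l l0; have := keys a l l0; rewrite !wcubeE// !lee_fin.
have H1 := wcube_gt0 a lH l0; have S1 := wcube_gt0 a lS l0.
have D1 := wcube_gt0 a ls l0; have W1 := wcube_gt0 a lw l0.
set hh := wcube H a l in H1 *; set ss := wcube S a l in S1 *.
set DD := wcube _ a l in D1 *; set WW := wcube _ a l in W1 *.
set L := (l ^+ d)%R; have L0 : (0 < L)%R by rewrite exprn_gt0.
move=> Dle Wle.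
have hq0 : (0 < hh / (B1 * L))%R by rewrite divr_gt0// mulr_gt0.
have sq0 : (0 < ss / (B2 * L))%R by rewrite divr_gt0// mulr_gt0.
have {}Dle : (DD `^ (p - 1) <= (ss / (B2 * L))^-1 * hh `^ (p - 1))%R.
  have -> : ((ss / (B2 * L))^-1 * hh `^ (p - 1) =
      ((ss / (B2 * L)) `^ (- r) * hh) `^ (p - 1))%R.
    rewrite (powRM _ (powR_ge0 _ _) (ltW H1)) -powRrM mulNr mulVf//.
    by rewrite (powR_inv1 (ltW sq0)).
  apply: ge0_ler_powR => //; [exact: ltW|by rewrite nnegrE ltW|].
  by rewrite nnegrE mulr_ge0 ?powR_ge0 ?(ltW H1).
apply: (le_trans (ler_pM (ltW W1) (powR_ge0 _ _) Wle Dle)).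
have BL0 : (0 < B1 * L)%R by rewrite mulr_gt0.
have hp : (0 < hh `^ (p - 1))%R by rewrite powR_gt0.
have Bp : (0 < B1 `^ (p - 1))%R by rewrite powR_gt0.
have Lp : (0 < L `^ (p - 1))%R by rewrite powR_gt0.
rewrite powRN (powRM _ (ltW H1)) ?invr_ge0 ?(ltW BL0)// (powRV _ (ltW BL0)).
rewrite (powRM _ (ltW B10) (ltW L0)) -(@mulr_powRB1 _ L p) ?(ltW L0)//; last lra.
rewrite le_eqVlt; apply/orP; left; apply/eqP.
by field; rewrite !gt_eqF.
Qed.

Lemma ApwZ (p K t : R) w : (0 < t)%R -> (1 < p)%R -> Apw p K w ->
  Apw p K (fun x => t * w x)%R.
Proof.
move=> t0 p1 [lw ls wK]; have [mw w0 wfin] := lw; have [ms s0 sfin] := ls.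
have p10 : (0 < p - 1)%R by lra.
have p1N0 : (p - 1 != 0)%R by rewrite gt_eqF.
have sE : dualw p (fun x => t * w x)%R = (fun x => t `^ (- (p - 1)^-1) * dualw p w x)%R.
  by apply/funext => x; rewrite /dualw (powRM _ (ltW t0) (ltW (w0 x))).
have lZ (c : R) (v : 'rV[R]_d -> R) : (0 < c)%R -> locally_finite_weight v ->
    locally_finite_weight (fun x => c * v x)%R /\
    forall a l, (0 < l)%R -> wcube (fun x => c * v x)%R a l = (c * wcube v a l)%R.
  move=> c0 lv; have [mv v0 vfin] := lv.
  have E a l : (0 < l)%R ->
      \int[mu]_(x in cube a l) (c * v x)%:E = (c * wcube v a l)%:E.
    move=> l0; under eq_integral do rewrite EFinM.
    rewrite ge0_integralZl_EFin; [|exact: measurable_cube|nneg|meas|exact: ltW].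
    by rewrite wcubeE.
  split; last by move=> a l l0; rewrite /wcube E.
  split; [meas|by move=> x; rewrite mulr_gt0|].
  by move=> a l l0; rewrite E// ltry.
have tr0 : (0 < t `^ (- (p - 1)^-1))%R by rewrite powR_gt0.
have [lw' wE] := lZ _ _ t0 lw; have [ls' sE'] := lZ _ _ tr0 ls.
split; [exact: lw'|by rewrite sE|move=> a l l0].
rewrite sE sE'// wE// (powRM _ (ltW tr0) (ltW (wcube_gt0 a ls l0))).
rewrite -powRrM mulNr mulVf// (powR_inv1 (ltW t0)) mulrACA mulfV ?gt_eqF// mul1r.
exact: wK.
Qed.

End A1_weights.

(** * Rubio de Francia extrapolation on one space *)

Section extrapolation.
Context (R : realType) (d : nat).
Local Open Scope ereal_scope.
Local Notation mu := (lebesgue_rV R d).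
Implicit Types (w H S : 'rV[R]_d -> R) (F G f g h : 'rV[R]_d -> \bar R).

(** With t the value of w, the right-hand side integrates to the p-th power of the norm in L^p(w)
    plus the p'-th power of that in L^p'(w^(1-p')). *)
Lemma young_dual (p p' x y t : R) : (1 < p)%R -> p' = (p / (p - 1))%R ->
  (0 < x)%R -> (0 < y)%R -> (0 < t)%R ->
  (x * y <= x `^ p * t + y `^ p' * t `^ (- (p - 1)^-1))%R.
Proof.
move=> p1 p'E x0 y0 t0.
have p10 : (0 < p - 1)%R by lra.
have p1N0 : (p - 1 != 0)%R by rewrite gt_eqF.
have [h|/ltW h] := leP y (x `^ (p - 1) * t)%R.
  rewrite -[leLHS]addr0; apply: lerD; last by rewrite mulr_ge0 ?powR_ge0.
  rewrite -(@mulr_powRB1 _ x p) ?(ltW x0)//; last lra.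
  by rewrite -mulrA; apply: ler_wpM2l => //; exact: ltW.
rewrite -[leLHS]add0r; apply: lerD; first by rewrite mulr_ge0 ?powR_ge0 ?ltW.
have -> : (y `^ p' * t `^ (- (p - 1)^-1) = (y * t^-1) `^ (p - 1)^-1 * y)%R.
  rewrite (powRM _ (ltW y0)) ?invr_ge0 ?(ltW t0)// (powRV _ (ltW t0)) -powRN.
  rewrite mulrAC -[X in (_ = _ * X * _)%R](powRr1 (ltW y0)) -powRD; last first.
    by apply/implyP => _; rewrite gt_eqF.
  by congr (_ `^ _ * _)%R; rewrite p'E; field.
apply: ler_wpM2r; first exact: ltW.
rewrite [leLHS](_ : x = (x `^ (p - 1)) `^ (p - 1)^-1)%R; last first.
  by rewrite -powRrM divff// powRr1// ltW.
apply: ge0_ler_powR; first by rewrite invr_ge0 ltW.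
- by rewrite nnegrE powR_ge0.
- by rewrite nnegrE mulr_ge0 ?invr_ge0 ?ltW.
- by rewrite ler_pdivlMr.
Qed.

(** Where G <= C x the second term suffices; elsewhere G = G^p0 G^(1-p0) <= G^p0 (C x)^(1-p0). Taken
    at x = H, y = S it makes the test weight S H^(1-p0) appear. *)
Lemma split_power (p0 C x y : R) (G : \bar R) : (1 < p0)%R -> (0 < C)%R ->
  (0 < x)%R -> (0 < y)%R -> 0 <= G ->
  G * y%:E <= (C `^ (- (p0 - 1)))%:E * (G `^ p0 * (y * x `^ (- (p0 - 1)))%:E) +
    C%:E * (x * y)%:E.
Proof.
move=> p1 C0 x0 y0.
have p10 : (0 <= p0 - 1)%R by lra.
have Cp : (0 < C `^ (- (p0 - 1)))%R by rewrite powR_gt0.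
have xp : (0 < y * x `^ (- (p0 - 1)))%R by rewrite mulr_gt0// powR_gt0.
have CH : (0 < C * x)%R by rewrite mulr_gt0.
case: G => [g| |]// g0; last first.
  rewrite poweRyr; last by rewrite gt_eqF//; lra.
  by rewrite [+oo * (_ * _)%:E]gt0_mulye ?lte_fin// [X in X + _]gt0_muley ?lte_fin// addye ?leey.
rewrite lee_fin in g0; rewrite poweR_EFin -!EFinM -EFinD lee_fin.
have [h|h] := leP g (C * x)%R.
  rewrite -[leLHS]add0r; apply: lerD; first by rewrite !mulr_ge0 ?powR_ge0 ?(ltW y0).
  by rewrite mulrA; apply: ler_wpM2r => //; exact: ltW.
have g1 : (0 < g)%R by exact: lt_trans h.
rewrite -[leLHS]addr0; apply: lerD; last by rewrite !mulr_ge0 ?ltW.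
have -> : (C `^ (- (p0 - 1)) * (g `^ p0 * (y * x `^ (- (p0 - 1)))) =
    (C * x) `^ (- (p0 - 1)) * g `^ p0 * y)%R.
  by rewrite (powRM _ (ltW C0) (ltW x0)); ring.
apply: ler_wpM2r; first exact: ltW.
apply: (@le_trans _ _ (g `^ (- (p0 - 1)) * g `^ p0)%R).
  rewrite -powRD; last by apply/implyP => _; rewrite gt_eqF.
  by rewrite (_ : - (p0 - 1) + p0 = 1)%R ?(powRr1 (ltW g1))//; ring.
by apply: ler_wpM2r; [exact: powR_ge0|apply: ge0_ler_powRN => //; exact: ltW].
Qed.

Lemma mule_poweRB1 (x : \bar R) (p : R) : (1 < p)%R -> 0 <= x ->
  x * x `^ (p - 1) = x `^ p.
Proof.
move=> p1; have p0 : (0 < p)%R by lra.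
have p10 : (0 < p - 1)%R by lra.
case: x => [x| |]// x0; first by rewrite !poweR_EFin -EFinM mulr_powRB1.
by rewrite !poweRyr ?gt_eqF.
Qed.

Lemma positive_unit_Lp (p : R) w : (0 < p)%R -> measurable_fun setT w ->
  (forall x, (0 < w x)%R) -> exists k : 'rV[R]_d -> \bar R,
  [/\ measurable_fun setT k, forall x, 0 < k x &
      \int[mu]_x (k x `^ p * (w x)%:E) <= 1].
Proof.
move=> p0 mw w0; have [e [me e0 ie]] := positive_integrable R d.
have pN0 : p != 0%R by rewrite gt_eqF.
exists (fun x => (e x * (w x `^ (-1))%:E) `^ p^-1); split.
- meas.
- by move=> x; rewrite poweR_gt0// mule_gt0// lte_fin powR_gt0.
- apply: le_trans ie; rewrite le_eqVlt; apply/orP; left; apply/eqP.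
  apply: eq_integral => x _; rewrite poweRVK//.
    by rewrite -muleA -EFinM powR_inv1 ?(ltW (w0 x))// mulVf ?mule1// gt_eqF.
  by apply: mule_ge0; [exact: ltW|rewrite lee_fin powR_ge0].
Qed.

Lemma integral_maxe_poweR_le (p : R) w f g : (0 < p)%R ->
  measurable_fun setT w -> (forall x, (0 < w x)%R) ->
  measurable_fun setT f -> (forall x, 0 <= f x) ->
  measurable_fun setT g -> (forall x, 0 <= g x) ->
  \int[mu]_x (maxe (f x) (g x) `^ p * (w x)%:E) <=
  \int[mu]_x (f x `^ p * (w x)%:E) + \int[mu]_x (g x `^ p * (w x)%:E).
Proof.
move=> p0 mw w0 mf f0 mg g0.
rewrite -ge0_integralD; [|by []|nneg|meas|nneg|meas].
apply: ge0_le_integral; [by []|nneg|meas|meas|].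
move=> x _; rewrite -ge0_muleDl; [|nneg|nneg].
apply: lee_wpmul2r; first by rewrite lee_fin ltW.
by case: (leP (f x) _) => _; rewrite ?leeDl ?leeDr// poweR_ge0.
Qed.

(** Truncating at multiples of a positive function of L^p(w) gives functions of finite norm that
    still exhaust g. *)
Lemma le_sup_mine_scaled (g k : \bar R) : 0 <= g -> 0 < k ->
  g <= ereal_sup (range (fun j : nat => mine g (j%:R%:E * k))).
Proof.
move=> g0 k0.
have ex (t : R) : exists j : nat, t%:E <= j%:R%:E * k.
  move: k k0 => [k| |]// k0; last by exists 1%N; rewrite mul1e leey.
  rewrite lte_fin in k0; exists (Num.trunc (t / k)).+1.
  by rewrite -EFinM lee_fin -ler_pdivrMr// ltW// truncnS_gt.
have ts (t : R) : t%:E <= g ->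
    t%:E <= ereal_sup (range (fun j : nat => mine g (j%:R%:E * k))).
  move=> tg; have [j tj] := ex t.
  apply: (@le_trans _ _ (mine g (j%:R%:E * k))); first by rewrite le_min tg.
  by apply: ereal_sup_ubound; exists j.
move: g g0 ts => [g| |]// _ ts; first exact: ts.
by rewrite [leRHS]eq_infty// => t; apply: ts; rewrite leey.
Qed.

(* The test weight is w0 = S H^(1 - p0), with H >= F and S >= h A_1 majorants in
   L^p(w) and L^p'(w^(1 - p')), where h is the function at which the truncated G
   attains its norm by duality. *)
Lemma extrapolation (p0 p K : R) : (1 < p0)%R -> (1 < p)%R ->
  exists2 K0 : R, (0 < K0)%R & forall w F, Apw p K w ->
  measurable_fun setT F -> (forall x, 0 <= F x) ->
  \int[mu]_x (F x `^ p * (w x)%:E) <= 1 ->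
  (exists2 w0, Apw p0 K0 w0 & \int[mu]_x (F x `^ p0 * (w0 x)%:E) < +oo) /\
  (forall G (C : R), measurable_fun setT G -> (forall x, 0 <= G x) ->
    (0 < C)%R ->
    (forall w0, Apw p0 K0 w0 -> \int[mu]_x (F x `^ p0 * (w0 x)%:E) <= 1 ->
       \int[mu]_x (G x `^ p0 * (w0 x)%:E) <= (C `^ p0)%:E) ->
    \int[mu]_x (G x `^ p * (w x)%:E) <= ((16 * C) `^ p)%:E).
Proof.
move=> p01 p1; have pp : (0 < p)%R by lra.
have p10 : (0 < p - 1)%R by lra.
have p1N0 : (p - 1 != 0)%R by rewrite gt_eqF.
have pN0 : (p != 0)%R by rewrite gt_eqF.
have [p' p'E] : exists p', p' = (p / (p - 1))%R by eexists.
have p'0 : (0 < p')%R by rewrite p'E divr_gt0.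
have p'N0 : (p' != 0)%R by rewrite gt_eqF.
have p'1 : (1 < p')%R by rewrite p'E ltr_pdivlMr//; lra.
have [B1 B10 RH] := @rubio_de_francia R d p K p1.
have [B2 B20 RS] := @rubio_de_francia R d p' (K `^ (p - 1)^-1)%R p'1.
exists (B1 `^ (p0 - 1) * B2)%R; first by rewrite mulr_gt0// powR_gt0.
move=> w F wA mF F0 F1; have [lw ls _] := wA.
have [mw w0 _] := lw; have [ms s0 _] := ls.
have sA : Apw p' (K `^ (p - 1)^-1) (dualw p w) by rewrite p'E; exact: Apw_dual.
set s := dualw p w in ls ms s0 sA.
have [k [mk k0 k1]] := positive_unit_Lp pp mw w0.
have [k' [mk' k'0 k'1]] := positive_unit_Lp p'0 ms s0.
have k0' x : 0 <= k x by exact: ltW.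
have k'0' x : 0 <= k' x by exact: ltW.
(* Joining [k] makes the function positive and at most doubles the integral; the majorant doubles it
   again, whence 4. *)
have [H [HA FH H4]] : exists H, [/\ A1w B1 H, {ae mu, forall x, F x <= (H x)%:E} &
    \int[mu]_x ((H x)%:E `^ p * (w x)%:E) <= 4%:E].
  have fk2 : \int[mu]_x (maxe (F x) (k x) `^ p * (w x)%:E) <= 2%:E.
    apply: le_trans (integral_maxe_poweR_le pp mw w0 mF F0 mk k0') _.
    by rewrite (_ : 2%:E = 1 + 1) ?leeD// -EFinD.
  have [|||H [HA fH HX]] := RH w (fun x => maxe (F x) (k x)) wA.
  - exact: measurable_maxe.
  - by move=> x; rewrite lt_max k0 orbT.
  - by apply: le_lt_trans fk2 _; rewrite ltry.
  exists H; split=> //.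
    by apply: filterS fH => x; apply: le_trans; rewrite le_max lexx.
  apply: (le_trans HX); rewrite (_ : 4%:E = 2%:E * 2%:E); first by rewrite lee_wpmul2l.
  by rewrite -EFinM -natrM.
(* [H] is already fixed. Both majorants have integrals at most 4, and [young_dual] bounds the
   integral of H S by 4 + 4. *)
have RS' h : measurable_fun setT h -> (forall x, 0 <= h x) ->
    \int[mu]_x (h x `^ p' * (s x)%:E) <= 1 ->
    exists S, [/\ A1w B2 S, {ae mu, forall x, h x <= (S x)%:E} &
      \int[mu]_x ((H x)%:E * (S x)%:E) <= 8%:E].
  move=> mh h0 h1.
  have fk2 : \int[mu]_x (maxe (h x) (k' x) `^ p' * (s x)%:E) <= 2%:E.
    apply: le_trans (integral_maxe_poweR_le p'0 ms s0 mh h0 mk' k'0') _.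
    by rewrite (_ : 2%:E = 1 + 1) ?leeD// -EFinD.
  have [|||S [SA hS SX]] := RS s (fun x => maxe (h x) (k' x)) sA.
  - exact: measurable_maxe.
  - by move=> x; rewrite lt_max k'0 orbT.
  - by apply: le_lt_trans fk2 _; rewrite ltry.
  exists S; split=> //.
    by apply: filterS hS => x; apply: le_trans; rewrite le_max lexx.
  have [mH H0 _] := HA; have [mS S0 _] := SA.
  have SX4 : \int[mu]_x ((S x)%:E `^ p' * (s x)%:E) <= 4%:E.
    apply: (le_trans SX); rewrite (_ : 4%:E = 2%:E * 2%:E); first by rewrite lee_wpmul2l.
    by rewrite -EFinM -natrM.
  apply: (@le_trans _ _ (\int[mu]_x ((H x)%:E `^ p * (w x)%:E + (S x)%:E `^ p' * (s x)%:E))).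
    apply: ge0_le_integral; [by []|nneg|meas|meas|].
    move=> x _; rewrite !poweR_EFin -!EFinM -EFinD lee_fin.
    exact: young_dual.
  rewrite ge0_integralD; [|by []|nneg|meas|nneg|meas].
  by rewrite (_ : 8%:E = 4%:E + 4%:E) ?leeD// -EFinD -natrD.
have [mH H0 _] := HA.
have Fw0 S : A1w B2 S -> \int[mu]_x ((H x)%:E * (S x)%:E) <= 8%:E ->
    \int[mu]_x (F x `^ p0 * (S x * H x `^ (- (p0 - 1)))%:E) <= 8%:E.
  move=> [mS S0 _] HS8; apply: le_trans HS8.
  apply: ae_ge0_le_integral; [by []|nneg|meas|nneg|meas|].
  apply: filterS FH => x FHx _.
  apply: (@le_trans _ _ ((H x)%:E `^ p0 * (S x * H x `^ (- (p0 - 1)))%:E)).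
    apply: lee_wpmul2r; first nneg.
    by apply: le_poweR => //; lra.
  rewrite poweR_EFin -!EFinM lee_fin mulrCA mulrA -mulrA -powRD; last first.
    by apply/implyP => _; rewrite gt_eqF.
  rewrite (_ : p0 + - (p0 - 1) = 1)%R; last by ring.
  by rewrite (powRr1 (ltW (H0 x))) mulrC.
(* For the existence clause any admissible [S] will do; the dual function is taken to be 0. *)
split.
  have [|||S [SA _ HS8]] := RS' (cst 0).
  - exact: measurable_cst.
  - by move=> x.
  - by rewrite integral0_eq// => x _; rewrite poweR0r// mul0e.
  exists (fun x => S x * H x `^ (- (p0 - 1)))%R; first exact: A1w_Apw.
  by apply: le_lt_trans (Fw0 S SA HS8) _; rewrite ltry.
move=> G C mG G0 C0 GC.
apply: (@le_trans _ _ (\int[mu]_x (ereal_sup (range (fun j : nat =>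
    mine (G x) (j%:R%:E * k x))) `^ p * (w x)%:E))).
  have mGj (j : nat) : measurable_fun setT (fun x => mine (G x) (j%:R%:E * k x)).
    by apply: measurable_mine => //; exact: emeasurable_funM.
  apply: ge0_le_integral; [by []|nneg|meas| |].
    apply: emeasurable_funM; last meas.
    apply: (measurableT_comp (measurable_poweR _)).
    exact: measurable_ereal_sup.
  move=> x _; apply: lee_wpmul2r; first nneg.
  apply: le_poweR => //; first exact: ltW.
  exact: le_sup_mine_scaled.
have mGj (j : nat) : measurable_fun setT (fun x => mine (G x) (j%:R%:E * k x)).
  by apply: measurable_mine => //; exact: emeasurable_funM.
have Gj0 (j : nat) x : 0 <= mine (G x) (j%:R%:E * k x).
  by rewrite le_min G0 mule_ge0// lee_fin.
apply: (@integral_poweR_sup_le _ _ _ _ (fun j x => mine (G x) (j%:R%:E * k x))) => //.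
  move=> x i j ij; rewrite le_min ge_min lexx /= ge_min; apply/orP; right.
  by apply: lee_wpmul2r => //; rewrite lee_fin ler_nat.
move=> j; pose g x := mine (G x) (j%:R%:E * k x).
have mg : measurable_fun setT g by exact: mGj.
have g0 x : 0 <= g x by exact: Gj0.
have gG x : g x <= G x by rewrite ge_min lexx.
rewrite -/(g _); set A := \int[mu]_x _.
have A0 : 0 <= A by nneg.
have Afin : A < +oo.
  apply: (@le_lt_trans _ _ (\int[mu]_x ((j%:R `^ p)%:E * (k x `^ p * (w x)%:E)))).
    apply: ge0_le_integral; [by []|nneg|meas|meas|].
    move=> x _; rewrite muleA -poweR_EFin -poweRM ?lee_fin//.
    apply: lee_wpmul2r; first nneg.
    by apply: le_poweR => //; [exact: ltW|rewrite ge_min lexx orbT].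
  rewrite ge0_integralZl_EFin; [|by []|nneg|meas|nneg_real].
  rewrite lte_mul_pinfty// ?lee_fin ?powR_ge0//.
  by apply: le_lt_trans k1 _; rewrite ltry.
have [A_eq0|A_neq0] := eqVneq A 0; first by rewrite A_eq0 lee_fin powR_ge0.
have [a aE] : exists a : R, A = a%:E.
  by exists (fine A); rewrite fineK// ge0_fin_numE.
have a0 : (0 < a)%R by rewrite -lte_fin -aE lt_def A_neq0.
(* The normalisation of the extremal dual function g^(p-1) w: it makes the integral of h^p' s equal
   to 1 and that of g h equal to a^(1/p). *)
pose b := (a `^ (- p'^-1))%R.
have b0 : (0 < b)%R by rewrite powR_gt0.
pose h x := b%:E * (g x `^ (p - 1) * (w x)%:E).
have mh : measurable_fun setT h by rewrite /h; meas.
have h0 x : 0 <= h x by rewrite /h; nneg.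
have h1 : \int[mu]_x (h x `^ p' * (s x)%:E) <= 1.
  have -> : \int[mu]_x (h x `^ p' * (s x)%:E) =
      \int[mu]_x ((a^-1)%:E * (g x `^ p * (w x)%:E)).
    apply: eq_integral => x _; rewrite /h poweRM ?lee_fin ?(ltW b0)//; last nneg.
    rewrite poweRM ?poweR_ge0 ?lee_fin ?(ltW (w0 x))// -poweRrM.
    have -> : ((p - 1) * p' = p)%R by rewrite p'E mulrC divfK.
    rewrite !poweR_EFin -!muleA -EFinM; congr (_%:E * (_ * _%:E)).
      rewrite /b -powRrM mulNr mulVf// powR_inv1 ?(ltW a0)//.
    rewrite /s /dualw -powRD; last by apply/implyP => _; rewrite gt_eqF.
    rewrite (_ : p' + _ = 1)%R; first by rewrite (powRr1 (ltW (w0 x))).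
    by rewrite p'E; field.
  rewrite ge0_integralZl_EFin; [|by []|nneg|meas|nneg_real].
  by rewrite -/A aE -EFinM mulVf// gt_eqF.
have [S [SA hS HS8]] := RS' h mh h0 h1.
have [mS S0 _] := SA.
pose v x := (S x * H x `^ (- (p0 - 1)))%R.
have vA : Apw p0 (B1 `^ (p0 - 1) * B2) v by exact: A1w_Apw.
have mv : measurable_fun setT v by case: vA => -[].
have v0 x : (0 < v x)%R by case: vA => -[].
(* The hypothesis on G asks for mass at most 1 of F, whereas [v] gives at most 8; it is applied to v
   / 8, which has the same A_p0 bound. *)
have Gv : \int[mu]_x (G x `^ p0 * (v x)%:E) <= (8 * C `^ p0)%:E.
  have e80 : (0 < 8^-1 :> R)%R by rewrite invr_gt0.
  have Z f : measurable_fun setT f -> (forall x, 0 <= f x) ->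
      \int[mu]_x (f x `^ p0 * (8^-1 * v x)%:E) =
      (8^-1)%:E * \int[mu]_x (f x `^ p0 * (v x)%:E).
    move=> mf f0; rewrite -ge0_integralZl_EFin; [|by []|nneg|meas|exact: ltW].
    by apply: eq_integral => x _; rewrite EFinM muleCA.
  have := GC _ (ApwZ e80 p01 vA); rewrite !Z// => GC'.
  have /GC' : (8^-1)%:E * \int[mu]_x (F x `^ p0 * (v x)%:E) <= 1.
    rewrite (_ : 1 = (8^-1)%:E * 8%:E) ?lee_wpmul2l//; last first.
      by rewrite -EFinM mulVf.
    exact: Fw0.
  by rewrite muleC lee_pdivrMr// mulrC EFinM.
(* Both terms of [split_power] integrate to at most 8 C. *)
have GS : \int[mu]_x (G x * (S x)%:E) <= (16 * C)%:E.
  apply: (@le_trans _ _ (\int[mu]_x ((C `^ (- (p0 - 1)))%:E * (G x `^ p0 * (v x)%:E) +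
      C%:E * ((H x)%:E * (S x)%:E)))).
    apply: ge0_le_integral; [by []|nneg|meas|meas|].
    by move=> x _; rewrite -[(H x)%:E * _]EFinM; exact: split_power.
  rewrite ge0_integralD; [|by []|nneg|meas|nneg|meas].
  rewrite ge0_integralZl_EFin; [|by []|nneg|meas|nneg_real].
  rewrite ge0_integralZl_EFin; [|by []|nneg|meas|nneg_real].
  apply: (@le_trans _ _ ((C `^ (- (p0 - 1)))%:E * (8 * C `^ p0)%:E + C%:E * 8%:E)).
    by apply: leeD; apply: lee_wpmul2l => //; rewrite lee_fin ?powR_ge0// ltW.
  rewrite -!EFinM -EFinD lee_fin mulrCA -powRD; last first.
    by apply/implyP => _; rewrite gt_eqF.
  rewrite (_ : - (p0 - 1) + p0 = 1)%R; last by ring.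
  rewrite (powRr1 (ltW C0)); lra.
have : (a `^ p^-1)%:E <= (16 * C)%:E.
  apply: le_trans GS.
  have -> : (a `^ p^-1)%:E = \int[mu]_x (g x * h x).
    have -> : \int[mu]_x (g x * h x) = \int[mu]_x (b%:E * (g x `^ p * (w x)%:E)).
      apply: eq_integral => x _; rewrite /h muleCA; congr (_ * _).
      rewrite muleA; congr (_ * _); exact: mule_poweRB1.
    rewrite ge0_integralZl_EFin; [|by []|nneg|meas|exact: ltW].
    rewrite -/A aE -EFinM; congr (_%:E); rewrite /b.
    rewrite -[X in (_ * X)%R](powRr1 (ltW a0)) -powRD; last first.
      by apply/implyP => _; rewrite gt_eqF.
    by congr (_ `^ _)%R; rewrite p'E; field; rewrite pN0 p1N0.
  apply: ae_ge0_le_integral; [by []|nneg|meas|nneg|meas|].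
  by apply: filterS hS => x hSx _; apply: lee_pmul.
rewrite lee_fin => aC; rewrite aE lee_fin.
rewrite [leLHS](_ : a = (a `^ p^-1) `^ p)%R; last first.
  by rewrite -powRrM mulVf// powRr1// ltW.
apply: ge0_ler_powR => //; [exact: ltW| |].
  by rewrite nnegrE powR_ge0.
by rewrite nnegrE mulr_ge0// ltW.
Qed.

End extrapolation.

Section integral_mono.
Context d (T : measurableType d) (R : realType) (mu : {measure set T -> \bar R}).
Local Open Scope ereal_scope.

(* No measurability of A: the integral of a nonnegative function is a supremum
   over the simple functions below it. *)
Lemma ge0_subset_integral_nonmeasurable (A B : set T) (f : T -> \bar R) :
  (forall x, 0 <= f x) -> A `<=` B ->
  \int[mu]_(x in A) f x <= \int[mu]_(x in B) f x.
Proof.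
move=> f0 AB; rewrite !ge0_integralE//; apply: le_ereal_sup => _ [h hf <-].
exists h => // x; apply: le_trans (hf x) _.
rewrite !patchE; case: ifPn => [|_]; last by case: ifP.
by rewrite inE => /AB Bx; rewrite mem_set.
Qed.

End integral_mono.

(** * Passage between A_p and its everywhere positive form *)

Section Ap_Apw.
Context (R : realType) (d : nat).
Local Open Scope ereal_scope.
Local Notation mu := (lebesgue_rV R d).
Implicit Types (w : 'rV[R]_d -> R) (f g : 'rV[R]_d -> \bar R).

Definition big_cube (n : nat) : set 'rV[R]_d :=
  cube (const_mx (- n.+1%:R)%R) (2 * n.+1%:R)%R.

Lemma big_cubeP n (x : 'rV[R]_d) :
  big_cube n x <-> forall k, (`|x ord0 k| <= n.+1%:R)%R.
Proof.
split=> [xn k|xn k].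
  by have := xn k; rewrite !mxE => /andP[? ?]; rewrite ler_norml; apply/andP; split; lra.
have := xn k; rewrite ler_norml !mxE => /andP[? ?]; apply/andP; split; lra.
Qed.

Lemma big_cube_nd n m : (n <= m)%N -> big_cube n `<=` big_cube m.
Proof.
move=> nm x /big_cubeP xn; apply/big_cubeP => k; apply: le_trans (xn k) _.
by rewrite ler_nat ltnS.
Qed.

Lemma bounded_sub_big_cube (A : set 'rV[R]_d) (M : R) :
  (forall x, A x -> forall k, (`|x ord0 k| <= M)%R) ->
  exists n, A `<=` big_cube n.
Proof.
move=> AM; exists (Num.trunc M) => x /AM xM; apply/big_cubeP => k.
by apply: (le_trans (xM k)); rewrite ltW// truncnS_gt.
Qed.

Lemma cube_sub_big_cube (a : 'rV[R]_d) (l : R) : exists n, cube a l `<=` big_cube n.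
Proof.
apply: (@bounded_sub_big_cube _ (\sum_k `|a ord0 k| + `|l|)%R) => x xa k.
have : (`|a ord0 k| <= \sum_k `|a ord0 k|)%R.
  by rewrite (bigD1 k)//= lerDl sumr_ge0.
have := xa k; have := ler_norm l; have := ler_norm (a ord0 k).
have := ler_norm (- a ord0 k)%R; rewrite normrN => ? ? ? /andP[? ?] ?.
by rewrite ler_norml; apply/andP; split; have := normr_ge0 l; lra.
Qed.

Lemma compact_sub_big_cube (A : set 'rV[R]_d) : compact A ->
  exists n, A `<=` big_cube n.
Proof.
move=> /compact_bounded [M [_ /(_ (M + 1)%R)]]; rewrite ltrDl ltr01 => /(_ isT) AM.
apply: (@bounded_sub_big_cube _ (M + 1)%R) => x Ax k.
apply: le_trans (AM x Ax); rewrite /Num.norm/= mx_normrE.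
exact: (le_bigmax _ (fun ij : 'I_1 * 'I_d => `|x ij.1 ij.2|)%R (ord0, k)).
Qed.

Lemma bigcup_big_cube (x : 'rV[R]_d) : exists n, big_cube n x.
Proof.
have [|n xn] := @bounded_sub_big_cube [set x] (\sum_k `|x ord0 k|)%R.
  by move=> y -> k; rewrite (bigD1 k)//= lerDl sumr_ge0.
by exists n; exact: xn.
Qed.

Lemma ae_big_cube (P : 'rV[R]_d -> Prop) :
  (forall n, {ae mu, forall x, big_cube n x -> P x}) -> {ae mu, forall x, P x}.
Proof.
move=> nP; have := ae_foralln nP; apply: filterS => x xP.
by have [n xn] := bigcup_big_cube x; exact: xP xn.
Qed.

Lemma hoelder_conjugate_exponent (p : R) : (1 < p)%R ->
  (1 - fine (hoelder_conjugate p%:E))%R = (- (p - 1)^-1)%R.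
Proof.
move=> p1; have p0 : (p != 0)%R by rewrite gt_eqF//; lra.
have p1N0 : (p - 1 != 0)%R by rewrite gt_eqF//; lra.
have <- : (p / (p - 1))%:E = hoelder_conjugate p%:E.
  apply/hoelder_conjugateP; [exact: ltNyr|by rewrite eqe|].
  rewrite !inver (negbTE p0) mulf_eq0 invr_eq0 (negbTE p0) (negbTE p1N0) /=.
  by rewrite -EFinD; congr (_%:E); field; rewrite p0 p1N0.
by rewrite /=; field.
Qed.

Lemma averageE (a : 'rV[R]_d) (l : R) f : (0 < l)%R ->
  average (cube a l) f = ((l ^+ d)^-1)%:E * \int[mu]_(x in cube a l) f x.
Proof.
move=> l0; rewrite /average lebesgue_rV_cube// inver gt_eqF// exprn_gt0//.
Qed.

Lemma dual_weight_gt0 (p : R) w x : (forall x, (0 <= w x)%R) ->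
  0 < dual_weight p w x.
Proof.
move=> w0; rewrite /dual_weight; case: eqP => [_|/eqP wx]; first exact: lt0y.
by rewrite lte_fin powR_gt0// lt_def wx w0.
Qed.

Lemma measurable_dual_weight (p : R) w : measurable_fun setT w ->
  measurable_fun setT (dual_weight p w).
Proof.
move=> mw; apply: measurable_fun_ifT; last 2 first.
- exact: measurable_cst.
- by apply/measurable_EFinP; exact: measurableT_comp (measurable_powR _) mw.
- apply: (measurable_fun_bool true); rewrite setTI.
  have := mw measurableT _ (measurable_set1 0%R); rewrite setTI; congr measurable.
  by apply/seteqP; split=> x /=; [move=> ->; rewrite eqxx|move/eqP].
Qed.

Lemma dual_weight_dualw (p : R) w x : (1 < p)%R -> (0 < w x)%R ->
  dual_weight p w x = (dualw p w x)%:E.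
Proof.
by move=> p1 wx; rewrite /dual_weight gt_eqF// hoelder_conjugate_exponent.
Qed.

Lemma Apw_Ap (p K : R) w : (1 < p)%R -> Apw p K w ->
  Ap p w /\ Ap_const p w <= K%:E.
Proof.
move=> p1 wA; have [lw ls wK] := wA; have [mw w0 wfin] := lw; have [ms s0 sfin] := ls.
have wE : dual_weight p w = (fun x => (dualw p w x)%:E).
  by apply/funext => x; rewrite dual_weight_dualw.
suff cK : Ap_const p w <= K%:E.
  split=> //; split; last by apply: le_lt_trans cK _; rewrite ltry.
  split; [by move=> x; exact: ltW|split=> //|].
    move=> A /compact_sub_big_cube[n An].
    apply: le_lt_trans (ge0_subset_integral_nonmeasurable _ _ An) _.
      by move=> x; rewrite lee_fin.
    under eq_integral do rewrite gtr0_norm//.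
    by apply: wfin; rewrite mulr_gt0.
  move=> w_eq0.
  have D0 : 0 < mu (cube 0%R 1%R) by rewrite lebesgue_rV_cube// lte_fin exprn_gt0.
  have [|x _ wx0] := @ae_exists R d _ (fun x => w x = 0%R) (measurable_cube _ _) D0.
    by apply: filterS w_eq0 => x.
  by have := w0 x; rewrite wx0 ltxx.
apply: ge_ereal_sup => _ [_ [a [l [l0 ->]]] <-].
have W_ : \int[mu]_(x in cube a l) (EFin \o w) x = (wcube w a l)%:E by exact: wcubeE.
have S_ : \int[mu]_(x in cube a l) dual_weight p w x = (wcube (dualw p w) a l)%:E.
  by rewrite wE; exact: wcubeE.
rewrite -/(cube a l) !averageE// W_ S_ -!EFinM lee_fin.
have L0 : (0 < l ^+ d)%R by rewrite exprn_gt0.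
have W0 := wcube_gt0 a lw l0; have S0 := wcube_gt0 a ls l0.
have := wK a l l0; set L := (l ^+ d)%R in L0 *; move=> WSL.
have Lp0 : (0 < L `^ p)%R by rewrite powR_gt0.
rewrite powRM ?invr_ge0 ?(ltW L0) ?(ltW S0)// (powRV _ (ltW L0)) powR_pred// invf_div.
rewrite [leLHS](_ : _ = wcube w a l * wcube (dualw p w) a l `^ (p - 1) / L `^ p)%R.
  by rewrite ler_pdivrMr.
by field; rewrite !gt_eqF.
Qed.

(** The dual weight is positive, so the A_p bound forces w(Q) to be finite. As w is not a.e. zero,
    every cube lies in a big cube with w(Q) > 0, where the bound makes the dual integral finite. The
    dual weight is +oo where w = 0, so w > 0 almost everywhere. *)
Lemma Ap_Apw (p K : R) w : (1 < p)%R -> Ap p w -> Ap_const p w <= K%:E ->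
  exists2 w', Apw p K w' & {ae mu, forall x, w x = w' x}.
Proof.
move=> p1 [[w0 [mw _] wN0] _] wK.
have p10 : (0 < p - 1)%R by lra.
pose s := dual_weight p w.
have s0 x : 0 < s x by exact: dual_weight_gt0.
have s0' x : 0 <= s x by exact: ltW.
have ms : measurable_fun setT s by exact: measurable_dual_weight.
have mEw : measurable_fun setT (EFin \o w) by exact/measurable_EFinP.
have mQ a l : measurable (cube a l : set 'rV[R]_d) by exact: measurable_cube.
pose W a l := \int[mu]_(x in cube a l) (w x)%:E.
pose S a l := \int[mu]_(x in cube a l) s x.
have W0 a l : 0 <= W a l by apply: integral_ge0 => x _; rewrite lee_fin.
have S0 a l : (0 < l)%R -> 0 < S a l.
  move=> l0; have D0 : 0 < mu (cube a l) by rewrite lebesgue_rV_cube// lte_fin exprn_gt0.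
  by apply: ge0_integral_gt0; [exact: mQ|exact: measurable_funTS|by []|exact: D0].
have WS a l : (0 < l)%R -> ((l ^+ d)^-1)%:E * W a l *
    (((l ^+ d)^-1)%:E * S a l) `^ (p - 1) <= K%:E.
  move=> l0; rewrite -!averageE//; apply: le_trans wK.
  by apply: ereal_sup_ubound; exists (cube a l) => //; exact: cubeP.
have L0 l : (0 < l)%R -> (0 < (l ^+ d)^-1)%R.
  by move=> l0; rewrite invr_gt0 exprn_gt0.
have Wfin a l : (0 < l)%R -> W a l < +oo.
  move=> l0; rewrite ltey; apply/eqP => Wy; have := WS a l l0; rewrite Wy.
  rewrite gt0_muley ?lte_fin ?L0// gt0_mulye// ?poweR_gt0 ?mule_gt0 ?lte_fin ?L0 ?S0//.
have Sfin_of a l : (0 < l)%R -> 0 < W a l -> S a l < +oo.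
  move=> l0 W1; rewrite ltey; apply/eqP => Sy; have := WS a l l0; rewrite Sy.
  rewrite [X in X `^ _]gt0_muley ?lte_fin ?L0// poweRyr ?gt_eqF// gt0_muley//.
  by rewrite mule_gt0// lte_fin L0.
have b0 n : (0 < 2 * n.+1%:R :> R)%R by rewrite mulr_gt0.
have [n0 Wn0] : exists n, 0 < \int[mu]_(x in big_cube n) (w x)%:E.
  apply: contrapT => nex; apply: wN0; apply: ae_big_cube => n.
  have Wn : \int[mu]_(x in big_cube n) `|(w x)%:E| = 0.
    rewrite (eq_integral (EFin \o w)); last by move=> x _; rewrite /= ger0_norm.
    apply/eqP; rewrite eq_le W0 andbT leNgt; apply/negP => Wn.
    by apply: nex; exists n.
  have := (ae_eq_integral_abs mu (mQ _ _) (measurable_funTS mEw)).1 Wn.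
  by apply: filterS => x /[apply] -[].
have Sfin a l : (0 < l)%R -> S a l < +oo.
  move=> l0; have [n1 an1] := cube_sub_big_cube a l.
  pose n := maxn n0 n1.
  have Wn : 0 < \int[mu]_(x in big_cube n) (w x)%:E.
    apply: lt_le_trans Wn0 _; apply: ge0_subset_integral; [exact: mQ|exact: mQ| | |].
    - exact: measurable_funTS.
    - by move=> x _; rewrite lee_fin.
    - by apply: big_cube_nd; exact: leq_maxl.
  apply: le_lt_trans (Sfin_of _ _ (b0 n) Wn).
  apply: ge0_subset_integral; [exact: mQ|exact: mQ|exact: measurable_funTS|by []|].
  by apply: subset_trans an1 _; apply: big_cube_nd; exact: leq_maxr.
have wae : {ae mu, forall x, (0 < w x)%R}.
  apply: ae_big_cube => n.
  have : mu.-integrable (big_cube n) s.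
    apply/integrableP; split; first exact: measurable_funTS.
    rewrite (eq_integral s); first exact: Sfin.
    by move=> x _; rewrite gee0_abs.
  move/(integrable_ae (mQ _ _)); apply: filterS => x /[apply].
  rewrite /s /dual_weight; case: eqP => // /eqP wx _.
  by rewrite lt_def wx w0.
pose w' x := if w x == 0%R then 1%R else w x.
have w'0 x : (0 < w' x)%R by rewrite /w'; case: eqP => // /eqP wx; rewrite lt_def wx w0.
have ww' x : (0 < w x)%R -> w x = w' x by move=> wx; rewrite /w' gt_eqF.
have mw' : measurable_fun setT w'.
  apply: measurable_fun_ifT => //.
  apply: (measurable_fun_bool true); rewrite setTI.
  have := mw measurableT _ (measurable_set1 0%R); rewrite setTI; congr measurable.
  by apply/seteqP; split=> x /=; [move=> ->; rewrite eqxx|move/eqP].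
have WE a l : \int[mu]_(x in cube a l) (w' x)%:E = W a l.
  apply: ge0_ae_eq_integral; [exact: mQ|meas|exact: measurable_funTS| | |].
  - by move=> x _; rewrite lee_fin ltW.
  - by move=> x _; rewrite lee_fin.
  - by apply: filterS wae => x wx _; rewrite ww'.
have ms' : measurable_fun setT (dualw p w').
  exact: measurableT_comp (measurable_powR _) mw'.
have SE a l : \int[mu]_(x in cube a l) (dualw p w' x)%:E = S a l.
  apply: ge0_ae_eq_integral; [exact: mQ|meas|exact: measurable_funTS| | |].
  - by move=> x _; rewrite lee_fin powR_ge0.
  - by [].
  - by apply: filterS wae => x wx _; rewrite /s dual_weight_dualw// /dualw -ww'.
exists w'; last by apply: filterS wae => x; exact: ww'.
have lw : locally_finite_weight w'.
  by split=> // a l l0; rewrite WE; exact: Wfin.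
have ls : locally_finite_weight (dualw p w').
  by split=> [//|x|a l l0]; [exact: powR_gt0|rewrite SE; exact: Sfin].
split=> // a l l0; have := WS a l l0.
rewrite -WE -SE !wcubeE// -!EFinM lee_fin.
have L1 : (0 < l ^+ d)%R by rewrite exprn_gt0.
have W1 := wcube_gt0 a lw l0; have S1 := wcube_gt0 a ls l0.
set L := (l ^+ d)%R in L1 *.
have Lp0 : (0 < L `^ p)%R by rewrite powR_gt0.
rewrite powRM ?invr_ge0 ?(ltW L1) ?(ltW S1)// (powRV _ (ltW L1)) powR_pred// invf_div.
rewrite [leLHS](_ : _ = wcube w' a l * wcube (dualw p w') a l `^ (p - 1) / L `^ p)%R.
  by rewrite ler_pdivrMr.
by field; rewrite !gt_eqF.
Qed.

Lemma Apw_le (p K K' : R) w : (K <= K')%R -> Apw p K w -> Apw p K' w.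
Proof.
move=> KK' [lw ls wK]; split=> // a l l0; apply: le_trans (wK a l l0) _.
by apply: ler_wpM2r => //; exact: powR_ge0.
Qed.

End Ap_Apw.

(** * Tensor products of weights *)

Section tensor.
Context (R : realType) (n m : nat).
Local Open Scope ereal_scope.
Implicit Types (u : 'rV[R]_n -> R) (v : 'rV[R]_m -> R).

Definition tensor u v (z : 'rV[R]_(n + m)) : R := (u (lsubmx z) * v (rsubmx z))%R.

Lemma measurable_lsubmx : measurable_fun setT (@lsubmx R 1 n m).
Proof.
apply/measurable_fun_rVP => k.
rewrite [X in measurable_fun _ X](_ : _ = fun z : 'rV[R]_(n + m) => z ord0 (lshift m k)).
  exact: measurable_rV_coord.
by apply/funext => z; rewrite mxE.
Qed.

Lemma measurable_rsubmx : measurable_fun setT (@rsubmx R 1 n m).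
Proof.
apply/measurable_fun_rVP => k.
rewrite [X in measurable_fun _ X](_ : _ = fun z : 'rV[R]_(n + m) => z ord0 (rshift n k)).
  exact: measurable_rV_coord.
by apply/funext => z; rewrite mxE.
Qed.

Lemma measurable_tensor u v : measurable_fun setT u -> measurable_fun setT v ->
  measurable_fun setT (tensor u v).
Proof.
move=> mu mv; apply: measurable_funM.
- exact: measurableT_comp mu measurable_lsubmx.
- exact: measurableT_comp mv measurable_rsubmx.
Qed.

Lemma integral_tensor_cube u v (a : 'rV[R]_(n + m)) (l : R) :
  locally_finite_weight u -> locally_finite_weight v -> (0 < l)%R ->
  \int[lebesgue_rV R (n + m)]_(z in cube a l) (tensor u v z)%:E =
  (wcube u (lsubmx a) l * wcube v (rsubmx a) l)%:E.
Proof.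
move=> lu lv l0; have [mu u0 _] := lu; have [mv v0 _] := lv.
have mQ b : measurable (cube b l : set 'rV[R]_(n + m)) by exact: measurable_cube.
have mt : measurable_fun setT (tensor u v) by exact: measurable_tensor.
have t0 z : (0 < tensor u v z)%R by rewrite mulr_gt0.
rewrite integral_mkcond ge0_integral_lebesgue_rVD; last 2 first.
- by apply/(measurable_restrictT _ (mQ a)); apply: measurable_funTS; exact/measurable_EFinP.
- by move=> z; rewrite patchE; case: ifP => // _; rewrite lee_fin ltW.
rewrite EFinM -wcubeE// -wcubeE//.
rewrite -ge0_integralZr; [|exact: measurable_cube| |
  by move=> x _; rewrite lee_fin ltW|]; last 2 first.
- by apply: measurable_funTS; exact/measurable_EFinP.
- by apply: integral_ge0 => x _; rewrite lee_fin ltW.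
rewrite [RHS]integral_mkcond; apply: eq_integral => x _.
rewrite [RHS]patchE.
have cE y : cube a l (row_mx x y) <-> cube (lsubmx a) l x /\ cube (rsubmx a) l y.
  split=> [xy|[xa ya] k].
    split=> k.
      by have := xy (lshift m k); rewrite row_mxEl mxE.
    by have := xy (rshift n k); rewrite row_mxEr mxE.
  case: (fintype.splitP k) => j kj.
    have -> : k = lshift m j by apply/val_inj.
    by rewrite row_mxEl; have := xa j; rewrite mxE.
  have -> : k = rshift n j by apply/val_inj.
  by rewrite row_mxEr; have := ya j; rewrite mxE.
case: ifPn => [|]; rewrite ?notin_setE ?inE => xa.
  rewrite -ge0_integralZl_EFin; [|exact: measurable_cube|
    by move=> y _; rewrite lee_fin ltW| |exact: ltW]; last first.
    by apply: measurable_funTS; exact/measurable_EFinP.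
  rewrite [RHS]integral_mkcond; apply: eq_integral => y _; rewrite !patchE.
  have -> : (row_mx x y \in cube a l) = (y \in cube (rsubmx a) l).
    apply/idP/idP; rewrite !inE; first by case/(cE y).1.
    by move=> ya; apply: (cE y).2.
  by case: ifP => // _; rewrite /tensor row_mxKl row_mxKr EFinM.
rewrite integral0_eq// => y _; rewrite patchE memNset//.
by case/(cE y).1.
Qed.

Lemma dualw_tensor (p : R) u v : (forall x, (0 < u x)%R) -> (forall x, (0 < v x)%R) ->
  dualw p (tensor u v) = tensor (dualw p u) (dualw p v).
Proof.
move=> u0 v0; apply/funext => z.
by rewrite /dualw /tensor powRM// ltW.
Qed.

Lemma locally_finite_tensor u v : locally_finite_weight u ->
  locally_finite_weight v -> locally_finite_weight (tensor u v).
Proof.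
move=> lu lv; have [mu u0 _] := lu; have [mv v0 _] := lv.
split; [exact: measurable_tensor|by move=> z; rewrite mulr_gt0|].
by move=> a l l0; rewrite integral_tensor_cube// ltry.
Qed.

(** A cube of R^{n+m} is a product of two cubes of the same side, and the dual of a tensor is the
    tensor of the duals, so every factor splits. *)
Lemma Apw_tensor (p K1 K2 : R) u v : Apw p K1 u -> Apw p K2 v ->
  Apw p (K1 * K2) (tensor u v).
Proof.
move=> uA vA; have K10 := Apw_gt0 uA; have K20 := Apw_gt0 vA.
case: uA vA => lu ldu uK [lv ldv vK].
have [_ u0 _] := lu; have [_ v0 _] := lv.
have dE := dualw_tensor p u0 v0.
split; [exact: locally_finite_tensor|by rewrite dE; exact: locally_finite_tensor|].
move=> a l l0; rewrite dE /wcube !integral_tensor_cube//=.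
set U := wcube u _ _; set V := wcube v _ _.
set U' := wcube (dualw p u) _ _; set V' := wcube (dualw p v) _ _.
have U0 : (0 < U)%R by exact: wcube_gt0.
have V0 : (0 < V)%R by exact: wcube_gt0.
have U'0 : (0 < U')%R by exact: wcube_gt0.
have V'0 : (0 < V')%R by exact: wcube_gt0.
rewrite (powRM _ (ltW U'0) (ltW V'0)) mulrACA exprD.
rewrite (powRM _ (exprn_ge0 _ (ltW l0)) (exprn_ge0 _ (ltW l0))) [leRHS]mulrACA.
apply: ler_pM; [| |exact: uK|exact: vK].
- by rewrite mulr_ge0 ?powR_ge0 ?(ltW U0).
- by rewrite mulr_ge0 ?powR_ge0 ?(ltW V0).
Qed.

Lemma integral_tensor u v (q : R) (F : 'rV[R]_(n + m) -> \bar R) :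
  measurable_fun setT u -> (forall x, (0 < u x)%R) ->
  measurable_fun setT v -> (forall x, (0 < v x)%R) ->
  measurable_fun setT F -> (forall z, 0 <= F z) ->
  \int[lebesgue_rV R (n + m)]_z (F z `^ q * (tensor u v z)%:E) =
  \int[lebesgue_rV R n]_x
    ((\int[lebesgue_rV R m]_y (F (row_mx x y) `^ q * (v y)%:E)) * (u x)%:E).
Proof.
move=> mu u0 mv v0 mF F0.
have mt : measurable_fun setT (tensor u v) by exact: measurable_tensor.
have t0 z : (0 < tensor u v z)%R by rewrite mulr_gt0.
rewrite ge0_integral_lebesgue_rVD; [|meas|nneg].
apply: eq_integral => x _.
have mFx : measurable_fun setT (fun y => F (row_mx x y)).
  have := measurableT_comp mF (measurableT_comp (@measurable_row_mx R n m) (measurable_pair1 x)).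
  by [].
rewrite -ge0_integralZr; [|by []|meas|nneg|nneg].
apply: eq_integral => y _; rewrite -muleA -EFinM mulrC.
by rewrite /tensor row_mxKl row_mxKr.
Qed.

End tensor.

(** * Extrapolation to mixed norms *)

Section mixed_extrapolation.
Context (R : realType) (n m : nat).
Local Open Scope ereal_scope.

Definition mixed_mass (p q : R) (u : 'rV[R]_n -> R) (v : 'rV[R]_m -> R)
    (F : 'rV[R]_(n + m) -> \bar R) : \bar R :=
  \int[lebesgue_rV R n]_x ((\int[lebesgue_rV R m]_y
    (F (row_mx x y) `^ q * (v y)%:E)) `^ (p / q) * (u x)%:E).

Lemma measurable_partial_mass (q : R) (v : 'rV[R]_m -> R) (F : 'rV[R]_(n + m) -> \bar R) :
  measurable_fun setT v -> (forall y, (0 < v y)%R) ->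
  measurable_fun setT F -> (forall z, 0 <= F z) ->
  measurable_fun setT (fun x => \int[lebesgue_rV R m]_y (F (row_mx x y) `^ q * (v y)%:E)).
Proof.
move=> mv v0 mF F0.
apply: (measurable_fun_fubini_tonelli_F (fun z : 'rV[R]_n * 'rV[R]_m =>
  F (row_mx z.1 z.2) `^ q * (v z.2)%:E)); last nneg.
apply: emeasurable_funM.
  apply: (measurableT_comp (measurable_poweR _)).
  exact: measurableT_comp mF (@measurable_row_mx R n m).
by apply/measurable_EFinP; exact: measurableT_comp mv _.
Qed.

Lemma mixed_extrapolation (p0 p q K : R) : (1 < p0)%R -> (1 < p)%R -> (1 < q)%R ->
  exists2 K0 : R, (0 < K0)%R &
  forall (u : 'rV[R]_n -> R) (v : 'rV[R]_m -> R) (F : 'rV[R]_(n + m) -> \bar R),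
  Apw p K u -> Apw q K v ->
  measurable_fun setT F -> (forall z, 0 <= F z) -> mixed_mass p q u v F <= 1 ->
  (exists2 w0, Apw p0 K0 w0 &
     \int[lebesgue_rV R (n + m)]_z (F z `^ p0 * (w0 z)%:E) < +oo) /\
  (forall G (C : R), measurable_fun setT G -> (forall z, 0 <= G z) -> (0 < C)%R ->
    (forall w0, Apw p0 K0 w0 ->
       \int[lebesgue_rV R (n + m)]_z (F z `^ p0 * (w0 z)%:E) <= 1 ->
       \int[lebesgue_rV R (n + m)]_z (G z `^ p0 * (w0 z)%:E) <= (C `^ p0)%:E) ->
    mixed_mass p q u v G <= ((16 * (16 * C)) `^ p)%:E).
Proof.
move=> p01 p1 q1; have qq : (0 < q)%R by lra.
have qN0 : q != 0%R by rewrite gt_eqF.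
have [K1 K10 ext1] := @extrapolation R n q p K q1 p1.
(* The test weights u' of the extrapolation on R^n have constant [K1], so [K1 * K] bounds that of
   [tensor u' v]. *)
have [K0 K00 ext2] := @extrapolation R (n + m) p0 q (K1 * K) p01 q1.
exists K0 => // u v F uA vA mF F0 F1.
have [lu _ _] := uA; have [mu u0 _] := lu.
have [lv _ _] := vA; have [mv v0 _] := lv.
pose slice (f : 'rV[R]_(n + m) -> \bar R) x :=
  (\int[lebesgue_rV R m]_y (f (row_mx x y) `^ q * (v y)%:E)) `^ q^-1.
have slice0 f x : 0 <= slice f x by exact: poweR_ge0.
have mslice f : measurable_fun setT f -> (forall z, 0 <= f z) ->
    measurable_fun setT (slice f).
  move=> mf f0; apply: (measurableT_comp (measurable_poweR _)).
  exact: measurable_partial_mass.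
have slicep f : mixed_mass p q u v f =
    \int[lebesgue_rV R n]_x (slice f x `^ p * (u x)%:E).
  by apply: eq_integral => x _; rewrite /slice -poweRrM mulrC.
have sliceq (f : 'rV[R]_(n + m) -> \bar R) (u' : 'rV[R]_n -> R) :
    measurable_fun setT f -> (forall z, 0 <= f z) ->
    measurable_fun setT u' -> (forall x, (0 < u' x)%R) ->
    \int[lebesgue_rV R n]_x (slice f x `^ q * (u' x)%:E) =
    \int[lebesgue_rV R (n + m)]_z (f z `^ q * (tensor u' v z)%:E).
  move=> mf f0 mu' u'0; rewrite integral_tensor//; apply: eq_integral => x _.
  by rewrite /slice poweRVK//; nneg.
have mS := mslice _ mF F0.
have [ex1 bd1] := ext1 u (slice F) uA mS (slice0 F) ltac:(by rewrite -slicep).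
split.
  have [u' u'A u'fin] := ex1; have [lu' _ _] := u'A; have [mu' u'0 _] := lu'.
  set X := \int[_]_x _ in u'fin.
  have X0 : 0 <= X by nneg.
  have Xf : X \is a fin_num by rewrite ge0_fin_numE.
  have x0 : (0 <= fine X)%R by exact: fine_ge0.
  (* The first extrapolation gives only a finite mass X, while the second asks for mass at most 1;
     u' is rescaled, and 1 + X is positive even if X = 0. *)
  pose t := (1 + fine X)^-1%R.
  have t0 : (0 < t)%R by rewrite invr_gt0; lra.
  have tuA := ApwZ t0 q1 u'A.
  have [ltu _ _] := tuA; have [mtu tu0 _] := ltu.
  have [|exw _] := ext2 _ F (Apw_tensor tuA vA) mF F0; last exact: exw.
  rewrite -sliceq//.
  have -> : \int[lebesgue_rV R n]_x (slice F x `^ q * (t * u' x)%:E) = t%:E * X.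
    rewrite /X -ge0_integralZl_EFin; [|by []|nneg|meas|exact: ltW].
    by apply: eq_integral => x _; rewrite EFinM muleCA.
  rewrite -(fineK Xf) -EFinM lee_fin /t mulrC ler_pdivrMr; lra.
move=> G C mG G0 C0 GC; rewrite slicep.
apply: bd1 => //; [exact: mslice|by rewrite mulr_gt0|].
move=> u' u'A; have [lu' _ _] := u'A; have [mu' u'0 _] := lu'.
rewrite !sliceq// => FX.
have [_ bd2] := ext2 _ F (Apw_tensor u'A vA) mF F0 FX.
exact: bd2.
Qed.

End mixed_extrapolation.

(** * Measurability of moduli, cut-offs and translates *)

Section complex_measurability.
Context (R : realType) (d : nat).
Implicit Types g : 'rV[R]_d -> R[i].

Lemma normcE (z : R[i]) :
  Normc.normc z = (complex.Re z ^+ 2 + complex.Im z ^+ 2) `^ 2^-1.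
Proof. by case: z => a b /=; rewrite powR12_sqrt// addr_ge0 ?sqr_ge0. Qed.

Lemma normc_ge0 (z : R[i]) : 0 <= Normc.normc z.
Proof. by rewrite normcE powR_ge0. Qed.

Lemma measurable_normc g : cmeasurable g ->
  measurable_fun setT (fun x => Normc.normc (g x)).
Proof.
move=> [mRe mIm].
rewrite [X in measurable_fun _ X](_ : _ = fun x =>
  (complex.Re (g x) ^+ 2 + complex.Im (g x) ^+ 2) `^ 2^-1); last first.
  by apply/funext => x; rewrite normcE.
apply: (measurableT_comp (measurable_powR _)).
by apply: measurable_funD; exact: measurable_funX.
Qed.

Lemma measurable_enorm : measurable_fun setT (@enorm R d).
Proof.
rewrite [X in measurable_fun _ X](_ : _ = fun x : 'rV[R]_d =>
  (\sum_(k < d) x ord0 k ^+ 2) `^ 2^-1); last first.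
  by apply/funext => x; rewrite powR12_sqrt// sumr_ge0// => k _; rewrite sqr_ge0.
apply: (measurableT_comp (measurable_powR _)).
apply: measurable_sum => k; apply: measurable_funX.
exact: measurable_rV_coord.
Qed.

Lemma measurable_normc_outside_ball r g : cmeasurable g ->
  measurable_fun setT (fun x => Normc.normc (outside_ball r g x)).
Proof.
move=> mg.
rewrite [X in measurable_fun _ X](_ : _ = fun x =>
    if enorm x < r then 0 else Normc.normc (g x)); last first.
  apply/funext => x; rewrite /outside_ball; case: ifP => // _.
  by rewrite normcE /= expr0n addr0 powR0// invr_eq0.
apply: measurable_fun_ifT; last exact: measurable_normc.
  by apply: measurable_fun_ltr; [exact: measurable_enorm|exact: measurable_cst].
exact: measurable_cst.
Qed.

Lemma measurable_addrV (h : 'rV[R]_d) :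
  measurable_fun setT (fun x : 'rV[R]_d => x + h).
Proof.
apply/measurable_fun_rVP => k.
rewrite [X in measurable_fun _ X](_ : _ = fun x : 'rV[R]_d => x ord0 k + h ord0 k).
  by apply: measurable_funD; [exact: measurable_rV_coord|exact: measurable_cst].
by apply/funext => x; rewrite mxE.
Qed.

Lemma measurable_normc_shift_diff h g : cmeasurable g ->
  measurable_fun setT (fun x => Normc.normc (shift_diff h g x)).
Proof.
move=> [mRe mIm]; apply: measurable_normc; split.
- rewrite [X in measurable_fun _ X](_ : _ = fun x =>
    complex.Re (g x) - complex.Re (g (x + h))); last first.
    by apply/funext => x; rewrite /shift_diff; case: (g x) => ? ?; case: (g (x + h)) => ? ?.
  apply: measurable_funB => //.
  exact: (measurableT_comp mRe (measurable_addrV h)).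
- rewrite [X in measurable_fun _ X](_ : _ = fun x =>
    complex.Im (g x) - complex.Im (g (x + h))); last first.
    by apply/funext => x; rewrite /shift_diff; case: (g x) => ? ?; case: (g (x + h)) => ? ?.
  apply: measurable_funB => //.
  exact: (measurableT_comp mIm (measurable_addrV h)).
Qed.

End complex_measurability.

(** * Norm bounds as bounds on integrals of powers *)

Section norms.
Context (R : realType).
Local Open Scope ereal_scope.

Lemma poweRV_le_EFin (x : \bar R) (p C : R) : (0 < p)%R -> (0 <= C)%R -> 0 <= x ->
  (x `^ p^-1 <= C%:E) = (x <= (C `^ p)%:E).
Proof.
move=> p0 C0 x0; rewrite poweR_le_inv ?invr_gt0 ?lee_fin//.
by rewrite invrK poweR_EFin.
Qed.

Lemma Lp_norm_le d (p C : R) (w : 'rV[R]_d -> R) (f : 'rV[R]_d -> R[i]) :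
  (0 < p)%R -> (0 <= C)%R -> (forall x, (0 <= w x)%R) ->
  (Lp_norm p w f <= C%:E) =
  (\int[lebesgue_rV R d]_x ((Normc.normc (f x))%:E `^ p * (w x)%:E) <= (C `^ p)%:E).
Proof.
move=> p0 C0 w0; rewrite /Lp_norm poweRV_le_EFin//.
by apply: integral_ge0 => x _; rewrite lee_fin mulr_ge0 ?powR_ge0.
Qed.

Lemma mixed_norm_le n m (p q C : R) (u : 'rV[R]_n -> R) (v : 'rV[R]_m -> R) f :
  (0 < p)%R -> (0 <= C)%R -> (forall x, (0 <= u x)%R) ->
  (mixed_norm p q u v f <= C%:E) =
  (mixed_mass p q u v (fun z => (Normc.normc (f z))%:E) <= (C `^ p)%:E).
Proof.
move=> p0 C0 u0; rewrite /mixed_norm poweRV_le_EFin//.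
by apply: integral_ge0 => x _; rewrite mule_ge0 ?poweR_ge0 ?lee_fin.
Qed.

Lemma ae_eq_mixed_mass n m (p q : R) (u u' : 'rV[R]_n -> R) (v v' : 'rV[R]_m -> R)
    (F : 'rV[R]_(n + m) -> \bar R) :
  measurable_fun setT u -> (forall x, (0 <= u x)%R) ->
  measurable_fun setT v -> (forall x, (0 <= v x)%R) ->
  measurable_fun setT u' -> (forall x, (0 < u' x)%R) ->
  measurable_fun setT v' -> (forall x, (0 < v' x)%R) ->
  {ae lebesgue_rV R n, forall x, u x = u' x} ->
  {ae lebesgue_rV R m, forall x, v x = v' x} ->
  measurable_fun setT F -> (forall z, 0 <= F z) ->
  mixed_mass p q u v F = mixed_mass p q u' v' F.
Proof.
move=> mu u0 mv v0 mu' u'0 mv' v'0 uu' vv' mF F0.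
have E x : \int[lebesgue_rV R m]_y (F (row_mx x y) `^ q * (v y)%:E) =
           \int[lebesgue_rV R m]_y (F (row_mx x y) `^ q * (v' y)%:E).
  have mFx : measurable_fun setT (fun y => F (row_mx x y)).
    exact: measurableT_comp mF (measurableT_comp (@measurable_row_mx R n m) (measurable_pair1 x)).
  apply: ge0_ae_eq_integral; [by []|meas|meas|nneg|nneg|].
  by apply: filterS vv' => y -> _.
rewrite /mixed_mass; under eq_integral do rewrite E.
have mI := measurable_partial_mass q mv' v'0 mF F0.
apply: ge0_ae_eq_integral; [by []|meas|meas|nneg|nneg|].
by apply: filterS uu' => x -> _.
Qed.

End norms.

(** * Transfer of the three clauses of uniform compactness *)

Theorem theorem3p6 (R : realType) (n m : nat)
    (n_gt0 : (0 < n)%N) (m_gt0 : (0 < m)%N)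
    (T : ('rV[R]_(n + m) -> R[i]) -> ('rV[R]_(n + m) -> R[i]))
    (p0 : R) (p0_gt1 : 1 < p0)
    (T_operator : operator p0 T)
    (T_compact : uniformly_compact_Lp p0 T) :
  forall p q : R, 1 < p -> 1 < q -> uniformly_compact_mixed p q T.
Proof.
case: T_operator => Tmeas _; case: T_compact => phi [[phi0 phimono] T1 T2 T3] p q p1 q1.
have p_gt0 : 0 < p by lra.
have p0_gt0 : 0 < p0 by lra.
(* Constants are chosen at the integers [N.+1] only; a real K is served by [N = Num.trunc K], since
   K < N + 1. *)
have /choice[K0 K0P] : forall N : nat, exists K0 : R,
    forall (u : 'rV[R]_n -> R) (v : 'rV[R]_m -> R) (F : 'rV[R]_(n + m) -> \bar R),
    Apw p N.+1%:R u -> Apw q N.+1%:R v ->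
    measurable_fun setT F -> (forall z, 0 <= F z)%E -> (mixed_mass p q u v F <= 1)%E ->
    (exists2 w0, Apw p0 K0 w0 &
       \int[lebesgue_rV R (n + m)]_z (F z `^ p0 * (w0 z)%:E) < +oo)%E /\
    (forall G (C : R), measurable_fun setT G -> (forall z, 0 <= G z)%E -> 0 < C ->
      (forall w0, Apw p0 K0 w0 ->
        (\int[lebesgue_rV R (n + m)]_z (F z `^ p0 * (w0 z)%:E) <= 1)%E ->
        (\int[lebesgue_rV R (n + m)]_z (G z `^ p0 * (w0 z)%:E) <= (C `^ p0)%:E)%E) ->
      (mixed_mass p q u v G <= ((16 * (16 * C)) `^ p)%:E)%E).
  move=> N; have [K0 _ K0P] := @mixed_extrapolation R n m p0 p q N.+1%:R p0_gt1 p1 q1.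
  by exists K0.
(* The clauses for L^{p0}(w) are available only at constants at least 1. *)
pose k N := Num.max 1 (K0 N).
have k1 N : 1 <= k N by rewrite le_max lexx.
have phik N : 0 < phi (k N) by apply: phi0; exact: lt_le_trans (k1 N).
pose c N := 256 * phi (k N).
have c_gt0 N : 0 < c N by rewrite mulr_gt0.
(* Summing over all lower levels makes the control function increasing; 256 = 16 * 16 is the loss of
   the two extrapolations. *)
pose psi (t : R) := \sum_(0 <= j < (Num.trunc t).+1) c j.
have c_psi (t : R) : c (Num.trunc t) <= psi t.
  by rewrite /psi big_nat_recr//= lerDr sumr_ge0// => j _; exact: ltW.
(* Each clause is an instance, with [g] equal to T f, its cut-off or its difference with a
   translate. *)
have core (K : R) (uv : ('rV[R]_n -> R) * ('rV[R]_m -> R)) (f : 'rV[R]_(n + m) -> R[i]) :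
    1 <= K ->
    [/\ Ap p uv.1, Ap q uv.2 & (maxe (Ap_const p uv.1) (Ap_const q uv.2) <= K%:E)%E] ->
    cmeasurable f -> (mixed_norm p q uv.1 uv.2 f <= 1)%E ->
    cmeasurable (T f) /\ forall (g : 'rV[R]_(n + m) -> R[i]) (C : R), 0 < C ->
      measurable_fun setT (fun z => Normc.normc (g z)) ->
      (forall w0, Ap p0 w0 -> (Ap_const p0 w0 <= (k (Num.trunc K))%:E)%E ->
        (Lp_norm p0 w0 f <= 1)%E -> (Lp_norm p0 w0 g <= C%:E)%E) ->
      (mixed_norm p q uv.1 uv.2 g <= (256 * C)%:E)%E.
  case: uv => u v /= K1 [uA vA]; rewrite ge_max => /andP[uK vK] mf f1.
  set N := Num.trunc K.
  have KN : K <= N.+1%:R by rewrite ltW// truncnS_gt.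
  have [u' u'A uu'] := Ap_Apw p1 uA uK; have {}u'A := Apw_le KN u'A.
  have [v' v'A vv'] := Ap_Apw q1 vA vK; have {}v'A := Apw_le KN v'A.
  have [[mu' u'0 _] _ _] := u'A; have [[mv' v'0 _] _ _] := v'A.
  have [[u0 [mu _] _] _] := uA; have [[v0 [mv _] _] _] := vA.
  pose F z := (Normc.normc (f z))%:E.
  have mnf := measurable_normc mf.
  have mF : measurable_fun setT F by exact/measurable_EFinP.
  have F0 z : (0 <= F z)%E by rewrite lee_fin normc_ge0.
  have F1 : (mixed_mass p q u' v' F <= 1)%E.
    rewrite -(ae_eq_mixed_mass p q mu u0 mv v0 mu' u'0 mv' v'0 uu' vv' mF F0).
    by move: f1; rewrite mixed_norm_le// powR1.
  have [exw bd] := K0P N u' v' F u'A v'A mF F0 F1.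
  split.
    (* A weight w0 with f in L^{p0}(w0) places f in the domain on which T has measurable values. *)
    have [w0 w0A w0fin] := exw; apply: Tmeas.
    have [w0Ap _] := Apw_Ap p0_gt1 w0A.
    by exists w0 => //; split=> //; exact: poweR_lty.
  move=> g C C0 mg gC; rewrite mixed_norm_le//; last by rewrite mulr_ge0// ltW.
  pose G z := (Normc.normc (g z))%:E.
  have mG : measurable_fun setT G by exact/measurable_EFinP.
  have G0 z : (0 <= G z)%E by rewrite lee_fin normc_ge0.
  rewrite (ae_eq_mixed_mass p q mu u0 mv v0 mu' u'0 mv' v'0 uu' vv' mG G0).
  rewrite (_ : 256 * C = 16 * (16 * C)); last by rewrite mulrA -natrM.
  apply: bd => // w0 w0A Fw0.
  have [w0Ap w0K] := Apw_Ap p0_gt1 w0A.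
  have w00 x : 0 <= w0 x by case: w0A => -[_ w00 _] _ _; exact: ltW.
  rewrite -Lp_norm_le//; last exact: ltW.
  apply: gC => //; first by apply: le_trans w0K _; rewrite lee_fin le_max lexx orbT.
  by rewrite Lp_norm_le// powR1.
exists psi; split.
- split=> [t t0|s t s0 st].
    rewrite /psi big_nat_recl//= ltr_pwDl// sumr_ge0// => j _; exact: ltW.
  rewrite /psi (@big_cat_nat _ _ _ (Num.trunc s).+1 0 (Num.trunc t).+1)//=.
    by rewrite lerDl sumr_ge0// => j _; exact: ltW.
  by rewrite ltnS le_truncn.
- move=> K K1 uv uvK; apply: ge_ereal_sup => _ [f [mf f1] <-].
  have [mTf bd] := core K uv f K1 uvK mf f1.
  apply: (@le_trans _ _ (256 * phi (k (Num.trunc K)))%:E); last by rewrite lee_fin c_psi.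
  apply: bd => //; first exact: measurable_normc.
  move=> w0 w0A w0K f1'; apply: le_trans (T1 _ (k1 _) w0 (conj w0A w0K)).
  by apply: ereal_sup_ubound; exists f.
- move=> eps K eps0 K1.
  (* The same [eps] is used in both settings, as the loss 256 is part of [psi]. *)
  have [r [r0 Tr]] := T2 eps (k (Num.trunc K)) eps0 (k1 _).
  exists r; split=> //.
  apply: ge_ereal_sup => _ [uv uvK <-]; apply: ge_ereal_sup => _ [f [mf f1] <-].
  have [mTf bd] := core K uv f K1 uvK mf f1.
  apply: (@le_trans _ _ (256 * (phi (k (Num.trunc K)) * eps))%:E); last first.
    by rewrite lee_fin mulrA ler_wpM2r ?(ltW eps0)// c_psi.
  apply: bd; [by rewrite mulr_gt0|exact: measurable_normc_outside_ball|].
  move=> w0 w0A w0K f1'; apply: le_trans Tr.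
  apply: (@le_trans _ _ (ereal_sup [set Lp_norm p0 w0 (outside_ball r (T f))
      | f in [set f | cmeasurable f /\ (Lp_norm p0 w0 f <= 1)%E]])).
    by apply: ereal_sup_ubound; exists f.
  by apply: ereal_sup_ubound; exists w0.
- move=> eps K eps0 K1.
  have [delta [delta0 Td]] := T3 eps (k (Num.trunc K)) eps0 (k1 _).
  exists delta; split=> // h hd.
  apply: ge_ereal_sup => _ [uv uvK <-]; apply: ge_ereal_sup => _ [f [mf f1] <-].
  have [mTf bd] := core K uv f K1 uvK mf f1.
  apply: (@le_trans _ _ (256 * (phi (k (Num.trunc K)) * eps))%:E); last first.
    by rewrite lee_fin mulrA ler_wpM2r ?(ltW eps0)// c_psi.
  apply: bd; [by rewrite mulr_gt0|exact: measurable_normc_shift_diff|].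
  move=> w0 w0A w0K f1'; apply: le_trans (Td h hd).
  apply: (@le_trans _ _ (ereal_sup [set Lp_norm p0 w0 (shift_diff h (T f))
      | f in [set f | cmeasurable f /\ (Lp_norm p0 w0 f <= 1)%E]])).
    by apply: ereal_sup_ubound; exists f.
  by apply: ereal_sup_ubound; exists w0.
Qed.
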